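(* Let $n\ge3$ and let $x\in\mathbb{R}^{E_n}$ be a $\frac12$-cyclic point such that $H_x$ is a union of vertex-disjoint cycles of length 4. Define $y$ by $y_e=\frac54$ for $e\in W_x$, $y_e=\frac32x_e$ for $e\in H_x$, and $y_e=0$ for $e\notin E_x$. Then $y\in\mathrm{TSP}(K_n)$.
   Context: $K_n$ is the complete graph on $V_n=\{1,\dots,n\}$ with edge set $E_n$; $\delta(U)$ denotes the set of edges with exactly one endpoint in $U$. $\mathrm{SUBT}(K_n)=\{x\in[0,1]^{E_n}: x(\delta(\{i\}))=2\ \forall i,\ x(\delta(U))\ge2\ \forall\,\emptyset\ne U\subsetneq V_n\}$. A tour of $K_n$ is a connected, spanning, Eulerian multigraph on $V_n$ with edges (possibly repeated) from $E_n$; $\mathrm{TSP}(K_n)$ is the convex hull of multiplicity vectors of tours. $G_x=(V_n,E_x)$, $E_x=\{e:x_e>0\}$. A $\frac12$-cyclic point is $x\in\mathrm{SUBT}(K_n)\cap\{0,\frac12,1\}^{E_n}$ such that $G_x$ has maximum degree at most 3 and every vertex is incident to an edge $e$ with $x_e=1$; $W_x=\{e:x_e=1\}$, $H_x=\{e:x_e=\frac12\}$. *)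

(* Defs.v *)
From HB Require Import structures.
From mathcomp Require Import all_boot all_order all_algebra.
Set Implicit Arguments. Unset Strict Implicit. Unset Printing Implicit Defensive.
Import Order.TTheory GRing.Theory Num.Theory.
Local Open Scope ring_scope.

(* Vertices of K_n: 'I_n (standing for 1..n).  Edges of K_n: unordered pairs
   {i,j}, i<>j, represented as ordered pairs (i,j) with i < j. *)
Definition edge (n : nat) := {e : 'I_n * 'I_n | (e.1 < e.2)%N}.

Definition incident n (v : 'I_n) (e : edge n) : bool :=
  (v == (val e).1) || (v == (val e).2).

Definition is_edge n (i j : 'I_n) (e : edge n) : bool :=
  (((val e).1 == i) && ((val e).2 == j)) || (((val e).1 == j) && ((val e).2 == i)).

Definition in_cut n (U : {set 'I_n}) (e : edge n) : bool :=
  ((val e).1 \in U) != ((val e).2 \in U).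

Definition cut_sum (R : numDomainType) n (x : edge n -> R) (U : {set 'I_n}) : R :=
  \sum_(e : edge n | in_cut U e) x e.

Definition in_SUBT (R : numDomainType) n (x : edge n -> R) : Prop :=
  (forall e, 0 <= x e <= 1) /\
  (forall i : 'I_n, cut_sum x [set i] = 2) /\
  (forall U : {set 'I_n}, U != set0 -> U != setT -> 2 <= cut_sum x U).

Definition is_half_cyclic (R : numFieldType) n (x : edge n -> R) : Prop :=
  in_SUBT x /\
  (forall e, x e = 0 \/ x e = 1 / 2 \/ x e = 1) /\
  (forall v : 'I_n, (#|[set e : edge n | (x e != 0%R) && incident v e]| <= 3)%N) /\
  (forall v : 'I_n, exists e : edge n, incident v e /\ x e = 1).

Definition in_W (R : numFieldType) n (x : edge n -> R) (e : edge n) : bool := x e == 1.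
Definition in_H (R : numFieldType) n (x : edge n -> R) (e : edge n) : bool := x e == 1 / 2.
Definition in_Ex (R : numFieldType) n (x : edge n -> R) (e : edge n) : bool := x e != 0.

Definition four_distinct n (c : 'I_n * 'I_n * 'I_n * 'I_n) : bool :=
  let: (a, b, c', d) := c in uniq [:: a; b; c'; d].
Definition cyc_verts n (c : 'I_n * 'I_n * 'I_n * 'I_n) : seq 'I_n :=
  let: (a, b, c', d) := c in [:: a; b; c'; d].
Definition cyc_edge n (c : 'I_n * 'I_n * 'I_n * 'I_n) (e : edge n) : bool :=
  let: (a, b, c', d) := c in
  [|| is_edge a b e, is_edge b c' e, is_edge c' d e | is_edge d a e].

Definition H_union_of_4cycles (R : numFieldType) n (x : edge n -> R) : Prop :=
  exists cs : seq ('I_n * 'I_n * 'I_n * 'I_n),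
    (forall c, c \in cs -> four_distinct c) /\
    (forall i j : nat, (i < j < size cs)%N ->
       forall c1 c2, c1 = nth c1 cs i -> c2 = nth c2 cs j ->
       [disjoint cyc_verts c1 & cyc_verts c2]) /\
    (forall e, in_H x e = has (fun c => cyc_edge c e) cs).

(* Tours: multiplicity vectors of connected spanning Eulerian multigraphs. *)
Definition degree n (m : edge n -> nat) (v : 'I_n) : nat :=
  (\sum_(e : edge n | incident v e) m e)%N.
Definition adj n (m : edge n -> nat) : rel 'I_n :=
  fun i j => [exists e : edge n, (0 < m e)%N && is_edge i j e].
Definition is_tour n (m : edge n -> nat) : Prop :=
  (forall i j : 'I_n, connect (adj m) i j) /\
  (forall v : 'I_n, ~~ odd (degree m v)).

Definition in_TSP (R : numFieldType) n (y : edge n -> R) : Prop :=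
  exists (k : nat) (lam : 'I_k -> R) (t : 'I_k -> edge n -> nat),
    (forall i, 0 <= lam i) /\ \sum_(i < k) lam i = 1 /\
    (forall i, is_tour (t i)) /\
    (forall e, y e = \sum_(i < k) lam i * (t i e)%:R).

Definition yvec (R : numFieldType) n (x : edge n -> R) (e : edge n) : R :=
  if in_W x e then 5 / 4 else if in_H x e then 3 / 2 * x e else 0.

(* Main.v *)
Require Import Defs.
From HB Require Import structures.
From mathcomp Require Import all_boot all_order all_algebra.
From mathcomp Require Import ring lra zify.
Set Implicit Arguments. Unset Strict Implicit. Unset Printing Implicit Defensive.
Import Order.TTheory GRing.Theory Num.Theory.
Local Open Scope ring_scope.

(** Write W for the 1-edges.  Each square of H_x carries two perfect matchings,
    p and q.

    (1) Kotzig: p and q can be interchanged on some squares so that W + p is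
    connected, i.e. a Hamiltonian cycle: as long as W + p is disconnected, some
    square has its two p-edges in different components, and interchanging p and
    q there merges these components.

    (2) Contract the q-edges.  In the resulting graph Q every contracted q-edge
    is incident with two 1-edges and, once the two parallel p-edges of each
    square are merged, with one square edge.  Weight 1/4 on the 1-edges and 1/2
    on the square edges is a fractional perfect matching of Q: an odd cut
    contains an odd number of square edges and an even number of 1-edges, and by
    the subtour constraints it is not a single square edge.  By Edmonds' theorem
    this point is a convex combination of perfect matchings P of Q.

    (3) From P build two tours: double the 1-edges of P; in the squares whose
    edge is in P keep both p-edges; in the other squares drop one p-edge (one
    tour for each choice of side), take both q-edges, and double a q-edge when
    the 1-edge of P it meets is attached to the dropped end.  Each dropped p-edge
    is bypassed through the rest of its square, so the tour stays connected, and
    the averages are 5/4 on W and 3/4 on H_x. *)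

(** * The perfect matching polytope *)

Definition cut_edges (E V : finType) (s t : E -> V) (U : {set V}) : {set E} :=
  [set e | (s e \in U) != (t e \in U)].

(** Edges are abstract elements with two end maps: parallel edges and loops are allowed, and a
    contraction keeps the edge type. Loops must carry weight 0. *)
Definition fractional_matching (R : realFieldType) (E V : finType) (s t : E -> V)
    (x : E -> R) : Prop :=
  [/\ forall e, 0 <= x e, forall e, s e = t e -> x e = 0,
      forall v, \sum_(e in cut_edges s t [set v]) x e = 1
    & forall U : {set V}, odd #|U| -> 1 <= \sum_(e in cut_edges s t U) x e].

(** A loop lies in no cut, so this condition alone does not exclude loops from [P]; in a convex
    combination they are excluded by their weight 0, through [matching_hull_support]. *)
Definition perfect_matching (E V : finType) (s t : E -> V) (P : {set E}) : Prop :=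
  forall v, #|P :&: cut_edges s t [set v]| = 1%N.

Definition matching_hull (R : realFieldType) (E V : finType) (s t : E -> V)
    (x : E -> R) : Prop :=
  exists mu : {set E} -> R,
    [/\ forall P, 0 <= mu P, forall P, mu P != 0 -> perfect_matching s t P,
        \sum_P mu P = 1 & forall e, \sum_(P : {set E} | e \in P) mu P = x e].

Section Cuts.
Variables (E V : finType) (s t : E -> V).

Lemma cut_edgesC (U : {set V}) : cut_edges s t (~: U) = cut_edges s t U.
Proof.
by apply/setP=> e; rewrite !inE; case: (s e \in U); case: (t e \in U).
Qed.

Lemma cut_edges_comp (V' : finType) (h : V -> V') (U' : {set V'}) :
  cut_edges (h \o s) (h \o t) U' = cut_edges s t (h @^-1: U').
Proof. by apply/setP=> e; rewrite !inE. Qed.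

End Cuts.

Section Mix.
Variables (R : realFieldType) (E V : finType) (s t : E -> V).

Lemma sum_neq0_ex (I : finType) (A : pred I) (f : I -> R) :
  \sum_(i | A i) f i != 0 -> exists2 i, A i & f i != 0.
Proof.
case: (pickP (fun i => A i && (f i != 0))) => [i /andP[]|none]; first by exists i.
by rewrite big1 ?eqxx // => i Ai; have:= none i; rewrite Ai => /negbFE/eqP.
Qed.

(** Different indices may give the same matching, so the masses over each matching are added up. *)
Lemma matching_hull_family (I : finType) (la : I -> R) (P : I -> {set E}) (x : E -> R) :
  (forall i, 0 <= la i) -> (forall i, la i != 0 -> perfect_matching s t (P i)) ->
  \sum_i la i = 1 -> (forall e, \sum_(i | e \in P i) la i = x e) ->
  matching_hull s t x.
Proof.
move=> la0 laP la1 lax.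
exists (fun Q => \sum_(i | P i == Q) la i); split.
- by move=> Q; apply: sumr_ge0.
- by move=> Q /sum_neq0_ex[i /eqP<-]; apply: laP.
- by rewrite -la1 (partition_big P predT).
- move=> e; rewrite -lax (partition_big P (fun Q => e \in Q)) //=.
  apply: eq_bigr => Q eQ; apply: eq_bigl => i.
  by case: eqP => [->|]; rewrite ?eQ ?andbF.
Qed.

Lemma matching_hull_convex (x y z : E -> R) a b : 0 <= a -> 0 <= b -> a + b = 1 ->
  matching_hull s t x -> matching_hull s t y -> (forall e, z e = a * x e + b * y e) ->
  matching_hull s t z.
Proof.
move=> a0 b0 ab [mu [m1 m2 m3 m4]] [nu [n1 n2 n3 n4]] zE.
exists (fun P => a * mu P + b * nu P); split.
- by move=> P; rewrite addr_ge0 ?mulr_ge0.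
- move=> P nz; have [m0|] := eqVneq (mu P) 0; last exact: m2.
  by apply: n2; apply: contraNneq nz => n0; rewrite m0 n0 !mulr0 addr0.
- by rewrite big_split /= -!mulr_sumr m3 n3 !mulr1.
- by move=> e; rewrite zE big_split /= -!mulr_sumr m4 n4.
Qed.

Lemma matching_hull_support (mu : {set E} -> R) (x : E -> R) P e :
  (forall P, 0 <= mu P) -> (forall e, \sum_(P : {set E} | e \in P) mu P = x e) ->
  mu P != 0 -> e \in P -> x e != 0.
Proof.
move=> mu0 mux nz eP; rewrite -mux; apply/negP=> /eqP/psumr_eq0P sum0.
by rewrite sum0 ?eqxx in nz.
Qed.

End Mix.

(** * Contraction, and gluing along a tight odd cut *)

Section Contract.
Variables (R : realFieldType) (E V V' : finType) (s t : E -> V) (h : V -> V').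

(** Edges that become loops get weight 0, as the loop condition requires; no cut of the contracted
    graph contains them. *)
Definition contract (x : E -> R) e := if h (s e) == h (t e) then 0 else x e.

Lemma sum_contract (x : E -> R) (U' : {set V'}) :
  \sum_(e in cut_edges (h \o s) (h \o t) U') contract x e
  = \sum_(e in cut_edges s t (h @^-1: U')) x e.
Proof.
rewrite cut_edges_comp; apply: eq_bigr => e; rewrite !inE /contract.
by case: ifP => // /eqP->; rewrite eqxx.
Qed.

(** Every fibre is odd and so counts as one vertex modulo 2. *)
Lemma odd_preim (U' : {set V'}) :
  (forall v', odd #|h @^-1: [set v']|) -> odd #|h @^-1: U'| = odd #|U'|.
Proof.
move=> oh; rewrite -sum1_card (partition_big h (mem U')) /=; last first.
  by move=> v; rewrite inE.
rewrite (eq_bigr (fun v' => #|h @^-1: [set v']|)); last first.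
  move=> v' v'U; rewrite -sum1_card; apply: eq_bigl => v.
  by rewrite !inE; case: eqP => [->|]; rewrite ?andbF // andbT.
rewrite -(sum1_card (mem U')) /=.
elim/big_rec2: _ => // v' y1 y2 _ e; rewrite !oddD e.
by rewrite (oh v').
Qed.

Lemma fractional_matching_contract (x : E -> R) : fractional_matching s t x ->
  (forall v', odd #|h @^-1: [set v']|) ->
  (forall v', \sum_(e in cut_edges s t (h @^-1: [set v'])) x e = 1) ->
  fractional_matching (h \o s) (h \o t) (contract x).
Proof.
case=> x0 xl xv xU oh sh; split.
- by move=> e; rewrite /contract; case: ifP.
- by move=> e /= he; rewrite /contract he eqxx.
- by move=> v'; rewrite sum_contract sh.
- by move=> U oU; rewrite sum_contract xU // odd_preim.
Qed.

End Contract.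

Section Glue.
Variables (R : realFieldType) (E V : finType) (s t : E -> V).

(** [insub] sends a vertex outside [U] to itself and all of [U] to [None], the contracted vertex. *)
Definition collapse (U : {set V}) : V -> option {v : V | v \notin U} := insub.

Lemma card_collapse (U : {set V}) :
  #|{: option {v : V | v \notin U}}| = (#|V| - #|U|).+1.
Proof.
rewrite card_option card_sig; congr _.+1.
by rewrite -(cardsC U) addKn; apply: eq_card => v; rewrite !inE.
Qed.

Lemma collapse_None (U : {set V}) : collapse U @^-1: [set None] = U.
Proof.
apply/setP=> v; rewrite !inE /collapse.
by case: insubP => [u /negbTE-> //|/negPn->].
Qed.

Lemma collapse_Some (U : {set V}) (u : {v : V | v \notin U}) :
  collapse U @^-1: [set Some u] = [set val u].
Proof.
apply/setP=> v; rewrite !inE /collapse.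
case: insubP => [w _ <-|]; first by rewrite (inj_eq (@Some_inj _)).
by move=> vU; symmetry; apply: contraNF vU => /eqP->; apply: (valP u).
Qed.

Lemma collapse_eq (U : {set V}) u v : u != v ->
  (collapse U u == collapse U v) = (u \in U) && (v \in U).
Proof.
move=> uv; rewrite /collapse.
case: insubP => [a /negbTE-> va|/negPn->]; case: insubP => [b /negbTE vU vb|/negPn ->] //=.
- by apply: contra_neqF uv => /eqP[ab]; rewrite -va -vb ab.
Qed.

Lemma fractional_matching_collapse (x : E -> R) (U : {set V}) : fractional_matching s t x -> odd #|U| ->
  \sum_(e in cut_edges s t U) x e = 1 ->
  fractional_matching (collapse U \o s) (collapse U \o t) (contract s t (collapse U) x).
Proof.
move=> fx oU xU; apply: fractional_matching_contract => // -[u|].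
- by rewrite collapse_Some cards1.
- by rewrite collapse_None.
- by rewrite collapse_Some; case: fx.
- by rewrite collapse_None.
Qed.

(** Edges inside [U] are loops of the contraction, have weight 0 and are therefore avoided; the
    degree condition at [None] becomes a single edge across the cut. *)
Lemma collapse_matchings (x : E -> R) (U : {set V}) :
  (forall e, s e = t e -> x e = 0) ->
  matching_hull (collapse U \o s) (collapse U \o t) (contract s t (collapse U) x) ->
  exists mu : {set E} -> R,
  [/\ forall P, 0 <= mu P,
      forall P, mu P != 0 ->
       [/\ forall e, e \in P -> ~~ ((s e \in U) && (t e \in U)),
           #|P :&: cut_edges s t U| = 1%N
         & forall v, v \notin U -> #|P :&: cut_edges s t [set v]| = 1%N],
      \sum_P mu P = 1
    & forall e, ~~ ((s e \in U) && (t e \in U)) ->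
        \sum_(P : {set E} | e \in P) mu P = x e].
Proof.
move=> xl [mu [mu0 mupm mu1 mux]]; exists mu; split=> //.
- move=> P nz; have pmP := mupm P nz; split.
  + move=> e eP; apply/negP=> /andP[sU tU].
    have := matching_hull_support mu0 mux nz eP.
    rewrite /contract; have [st|st] := eqVneq (s e) (t e); first by rewrite st !eqxx.
    by rewrite collapse_eq // sU tU eqxx.
  + by have := pmP None; rewrite cut_edges_comp collapse_None.
  + by move=> v vU; have := pmP (Some (Sub v vU)); rewrite cut_edges_comp collapse_Some.
- move=> e eU; rewrite mux /contract.
  have [st|st] := eqVneq (s e) (t e); first by rewrite st eqxx xl.
  by rewrite collapse_eq // (negbTE eU).
Qed.

Lemma card1_inj (A : {set E}) a b : #|A| = 1%N -> a \in A -> b \in A -> a = b.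
Proof.
by move=> /eqP/cards1P[c ->]; rewrite !inE => /eqP-> /eqP->.
Qed.

Lemma cut_edges1_cut (U : {set V}) v f : f \in cut_edges s t [set v] -> v \in U ->
  ~~ ((s f \in U) && (t f \in U)) -> f \in cut_edges s t U.
Proof.
rewrite !inE; case: (eqVneq (s f) v) => [->|_]; case: (eqVneq (t f) v) => [->|_] //= _ ->.
  by case: (_ \in _).
by rewrite andbT; case: (_ \in _).
Qed.

(** [e] is the only edge across the cut in [P1] and in [P2], so at each vertex the matching of the
    other side adds nothing new. *)
Lemma glue_matching (U : {set V}) (P1 P2 : {set E}) e :
  (forall f, f \in P1 -> ~~ ((s f \in U) && (t f \in U))) ->
  #|P1 :&: cut_edges s t U| = 1%N ->
  (forall v, v \notin U -> #|P1 :&: cut_edges s t [set v]| = 1%N) ->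
  (forall f, f \in P2 -> ~~ ((s f \notin U) && (t f \notin U))) ->
  #|P2 :&: cut_edges s t U| = 1%N ->
  (forall v, v \in U -> #|P2 :&: cut_edges s t [set v]| = 1%N) ->
  e \in cut_edges s t U -> e \in P1 -> e \in P2 ->
  perfect_matching s t (P1 :|: P2).
Proof.
move=> a1 b1 c1 a2 b2 c2 eU e1 e2 v.
case: (boolP (v \in U)) => vU.
- rewrite -(c2 v vU); congr #|pred_of_set _|; apply/setP=> f; rewrite !in_setI in_setU.
  case: (boolP (f \in P2)) => f2; rewrite ?orbT // orbF /=.
  case: (boolP (f \in P1)) => f1 //=; apply/negP=> fv.
  have fU : f \in cut_edges s t U by apply: cut_edges1_cut fv vU (a1 f f1).
  by move: f2; rewrite (card1_inj b1 (a := f) (b := e)) ?e2 // in_setI ?f1 ?e1.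
- rewrite -(c1 v vU); congr #|pred_of_set _|; apply/setP=> f; rewrite !in_setI in_setU.
  case: (boolP (f \in P1)) => f1; rewrite ?orbT //=.
  case: (boolP (f \in P2)) => f2 //=; apply/negP=> fv.
  have fU : f \in cut_edges s t U.
    by rewrite -cut_edgesC; apply: cut_edges1_cut fv _ _; rewrite !inE ?(a2 f f2).
  by move: f1; rewrite (card1_inj b2 (a := f) (b := e)) ?e1 // in_setI ?f2 ?e2.
Qed.

End Glue.

Section GlueStep.
Variables (R : realFieldType) (E V : finType) (s t : E -> V).

(** Draw a cut edge [e] with probability [x e], then independently two matchings containing it: the
    joint mass is [mu1 P1 * mu2 P2 / x e]. Since [P1] contains exactly one cut edge, its law is
    again [mu1]. *)
Lemma glue_marginal (C : {set E}) (mu1 mu2 : {set E} -> R) (x : E -> R)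
    (g : {set E} -> R) :
  (forall P, 0 <= mu1 P) -> (forall P, mu1 P != 0 -> #|P :&: C| = 1%N) ->
  (forall e, e \in C -> \sum_(P : {set E} | e \in P) mu1 P = x e) ->
  (forall e, e \in C -> \sum_(P : {set E} | e \in P) mu2 P = x e) ->
  \sum_(e in C) \sum_(P1 : {set E} | e \in P1) \sum_(P2 : {set E} | e \in P2)
     g P1 * (mu1 P1 * mu2 P2 / x e) = \sum_P g P * mu1 P.
Proof.
move=> mu0 muC mu1x mu2x.
transitivity (\sum_(e in C) \sum_(P1 : {set E} | e \in P1) g P1 * mu1 P1).
  apply: eq_bigr => e eC; apply: eq_bigr => P1 eP1.
  (* If [x e = 0] the quotient is 0 by convention, and [mu1 P1] vanishes as well. *)
  have [x0|xn] := eqVneq (x e) 0.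
    have := mu1x e eC; rewrite x0 => /psumr_eq0P s0.
    rewrite (s0 _ P1 eP1) // mulr0 big1 // => P2 _.
    by rewrite !mul0r mulr0.
  by rewrite -mulr_sumr -mulr_suml -mulr_sumr mu2x // mulfK.
rewrite (exchange_big_dep predT) //=; apply: eq_bigr => P _.
have [->|nz] := eqVneq (mu1 P) 0; first by rewrite mulr0 big1 // => e _; rewrite mulr0.
rewrite (eq_bigl [in P :&: C]) => [|e]; last by rewrite inE andbC.
by rewrite sumr_const muC.
Qed.

Lemma glue (x : E -> R) (U : {set V}) :
  fractional_matching s t x -> \sum_(e in cut_edges s t U) x e = 1 ->
  matching_hull (collapse U \o s) (collapse U \o t) (contract s t (collapse U) x) ->
  matching_hull (collapse (~: U) \o s) (collapse (~: U) \o t)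
     (contract s t (collapse (~: U)) x) ->
  matching_hull s t x.
Proof.
move=> [x0 xl xv xU] xU1 /(collapse_matchings xl)[mu1 [m10 m1pm m11 m1x]].
move=> /(collapse_matchings xl)[mu2 [m20 m2pm m21 m2x]].
set C := cut_edges s t U.
have C1 e : e \in C -> \sum_(P : {set E} | e \in P) mu1 P = x e.
  by rewrite inE => eC; apply: m1x; move: eC; case: (_ \in U); case: (_ \in U).
have C2 e : e \in C -> \sum_(P : {set E} | e \in P) mu2 P = x e.
  by rewrite inE => eC; apply: m2x; move: eC; rewrite !inE; case: (_ \in U); case: (_ \in U).
have c1 P : mu1 P != 0 -> #|P :&: C| = 1%N by case/m1pm.
have c2 P : mu2 P != 0 -> #|P :&: C| = 1%N by case/m2pm; rewrite cut_edgesC.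
(* The joint law of the common cut edge and the two matchings, independent given that edge. *)
pose la (i : E * ({set E} * {set E})) :=
  let: (e, (P1, P2)) := i in
  if [&& e \in C, e \in P1 & e \in P2] then mu1 P1 * mu2 P2 / x e else 0.
have la_sum (F : E -> {set E} -> {set E} -> bool) :
  \sum_(i | F i.1 i.2.1 i.2.2) la i =
  \sum_(e in C) \sum_(P1 : {set E} | e \in P1) \sum_(P2 : {set E} | e \in P2)
    (F e P1 P2)%:R * (mu1 P1 * mu2 P2 / x e).
  rewrite big_mkcond [RHS]big_mkcond /=.
  rewrite (eq_bigr (fun i => (fun e P => if F e P.1 P.2 then la (e, P) else 0) i.1 i.2)); last by case=> e [].
  rewrite -(pair_bigA _ (fun e P => if F e P.1 P.2 then la (e, P) else 0)) /=.
  apply: eq_bigr => e _.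
  rewrite (eq_bigr (fun i => (fun P1 P2 => if F e P1 P2 then la (e, (P1, P2)) else 0) i.1 i.2)); last by case.
  rewrite -(pair_bigA _ (fun P1 P2 => if F e P1 P2 then la (e, (P1, P2)) else 0)) /=.
  case: (e \in C) => /=; last by rewrite big1 // => P1 _; rewrite big1 // => P2 _; case: ifP.
  rewrite [RHS]big_mkcond; apply: eq_bigr => P1 _ /=.
  case: (e \in P1) => /=; last by rewrite big1 // => P2 _; case: ifP.
  rewrite [RHS]big_mkcond; apply: eq_bigr => P2 _ /=.
  by case: (e \in P2); case: (F _ _ _); rewrite ?mul1r ?mul0r.
apply: (@matching_hull_family _ _ _ _ _ _ la (fun i => i.2.1 :|: i.2.2)).
- move=> [e [P1 P2]] /=; case: ifP => // _.
  by rewrite mulr_ge0 ?invr_ge0 // mulr_ge0.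
- move=> [e [P1 P2]] /=; case: ifP => [/and3P[eC e1 e2] nz|]; last by rewrite eqxx.
  have n1 : mu1 P1 != 0 by apply: contraNneq nz => ->; rewrite !mul0r.
  have n2 : mu2 P2 != 0 by apply: contraNneq nz => ->; rewrite mulr0 mul0r.
  have [a1 b1 d1] := m1pm _ n1; have [a2 b2 d2] := m2pm _ n2.
  apply: (@glue_matching _ _ s t U P1 P2 e) => //.
  + by move=> f /a2; rewrite !inE.
  + by rewrite -(cut_edgesC s t U).
  + by move=> v vU; apply: d2; rewrite inE negbK.
- rewrite (la_sum (fun _ _ _ => true)) (@glue_marginal C mu1 mu2 x (fun=> 1)) //.
  by rewrite -[RHS]m11; apply: eq_bigr => P _; rewrite mul1r.
- move=> f; rewrite (la_sum (fun _ P1 P2 => f \in P1 :|: P2)).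
  (* A cut edge [f] lies in the union only if it is the common edge. An edge with both ends outside
     [U] can only come from [P1], one with both ends inside only from [P2]. *)
  case: (boolP (f \in C)) => fC.
    transitivity (\sum_(e in C) if e == f then x f else 0).
      apply: eq_bigr => e eC; have [ef|ef] := eqVneq e f.
        rewrite -ef; transitivity (\sum_(P1 : {set E} | e \in P1) mu1 P1); last by rewrite C1.
        apply: eq_bigr => P1 e1.
        have [x00|xn] := eqVneq (x e) 0.
          have := C1 e eC; rewrite x00 => /psumr_eq0P s0.
          rewrite (s0 _ P1 e1) // big1 // => P2 _.
          by rewrite !mul0r mulr0.
        rewrite -[RHS](mulfK xn) -(C2 _ eC) mulr_sumr mulr_suml.
        by apply: eq_bigr => P2 e2; rewrite inE e1 mul1r C2.
      rewrite big1 // => P1 e1; rewrite big1 // => P2 e2.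
      have [->|n1] := eqVneq (mu1 P1) 0; first by rewrite !mul0r mulr0.
      have [->|n2] := eqVneq (mu2 P2) 0; first by rewrite mulr0 mul0r mulr0.
      rewrite in_setU; case: (boolP (f \in P1)) => [f1|_].
        by rewrite (card1_inj (c1 _ n1) (a := e) (b := f)) ?in_setI ?e1 ?f1 ?eC ?fC ?eqxx in ef.
      case: (boolP (f \in P2)) => [f2|_]; last by rewrite mul0r.
      by rewrite (card1_inj (c2 _ n2) (a := e) (b := f)) ?in_setI ?e2 ?f2 ?eC ?fC ?eqxx in ef.
    rewrite -big_mkcondr (big_pred1 f) // => e /=.
    by case: (eqVneq e f) => [->|_]; rewrite ?fC ?andbF.
  case: (boolP (s f \in U)) => sU; last first.
    have tU : t f \notin U by move: fC; rewrite inE (negbTE sU); case: (_ \in U).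
    transitivity (\sum_(P : {set E}) (f \in P)%:R * mu1 P); last first.
      rewrite -m1x ?(negbTE sU) // [RHS]big_mkcond; apply: eq_bigr => P _ /=.
      by case: (f \in P); rewrite ?mul1r ?mul0r.
    rewrite -(@glue_marginal C mu1 mu2 x (fun P : {set E} => (f \in P)%:R)) //.
    apply: eq_bigr => e eC; apply: eq_bigr => P1 e1; apply: eq_bigr => P2 e2.
    have [->|n2] := eqVneq (mu2 P2) 0; first by rewrite mulr0 mul0r !mulr0.
    rewrite in_setU [f \in P2](_ : _ = false) ?orbF //.
    by apply/negP=> f2; have [/(_ f f2)] := m2pm _ n2; rewrite !inE sU tU.
  have tU : t f \in U by move: fC; rewrite inE sU; case: (_ \in U).
  transitivity (\sum_(P : {set E}) (f \in P)%:R * mu2 P); last first.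
    rewrite -m2x ?inE ?sU // [RHS]big_mkcond; apply: eq_bigr => P _ /=.
    by case: (f \in P); rewrite ?mul1r ?mul0r.
  rewrite -(@glue_marginal C mu2 mu1 x (fun P : {set E} => (f \in P)%:R)) //.
  apply: eq_bigr => e eC; rewrite exchange_big /=; apply: eq_bigr => P2 e2; apply: eq_bigr => P1 e1.
  have [->|n1] := eqVneq (mu1 P1) 0; first by rewrite mulr0 !mul0r !mulr0.
  rewrite in_setU [f \in P1](_ : _ = false) ?orFb 1?[mu2 _ * _]mulrC //.
  by apply/negP=> f1; have [/(_ f f1)] := m1pm _ n1; rewrite sU tU.
Qed.

End GlueStep.

(** * Moving along a circulation *)

Definition support_set (R : realFieldType) (E : finType) (x : E -> R) : {set E} :=
  [set e | x e != 0].

(** Both shores have more than one vertex, so both contractions are smaller than the graph. *)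
Definition tight_cut (R : realFieldType) (E V : finType) (s t : E -> V)
    (x : E -> R) (U : {set V}) : Prop :=
  [/\ odd #|U|, (1 < #|U|)%N, (#|U|.+1 < #|V|)%N
    & \sum_(e in cut_edges s t U) x e = 1].

(** A nonzero kernel vector of the unoriented incidence matrix, carried by the support of [x]. *)
Definition circulation (R : realFieldType) (E V : finType) (s t : E -> V)
    (x d : E -> R) : Prop :=
  [/\ exists e, d e != 0, forall e, x e = 0 -> d e = 0
    & forall v, \sum_(e in cut_edges s t [set v]) d e = 0].

Section Push.
Variables (R : realFieldType) (E V : finType) (s t : E -> V).

Lemma circulation_neg (x d : E -> R) : fractional_matching s t x -> circulation s t x d ->
  exists e, d e < 0.
Proof.
move=> [x0 xl xv xU] [[e de] dx dv].
have [dneg|dpos|d0] := ltrgtP (d e) 0; first by exists e.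
- have eC : e \in cut_edges s t [set s e].
    rewrite !inE eqxx; apply/negP=> /eqP/esym/eqP te.
    by move: de; rewrite dx ?eqxx ?xl.
  case: (pickP (fun f => d f < 0)) => [f|none]; first by exists f.
  have := dv (s e); rewrite (bigD1 e) //= => /eqP; rewrite paddr_eq0 ?(ltW dpos) //.
    by rewrite gt_eqF.
  by apply: sumr_ge0 => f _; rewrite leNgt none.
- by rewrite d0 eqxx in de.
Qed.

(** A ratio test: [eps] is the least ratio of slack to rate of decrease. No constraint is violated,
    and the first one to become tight is an edge leaving the support or a nontrivial odd cut. *)
Lemma push_circulation (x d : E -> R) : fractional_matching s t x -> circulation s t x d ->
  (forall U, ~ tight_cut s t x U) ->
  exists eps, [/\ 0 < eps, fractional_matching s t (fun e => x e + eps * d e)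
   & (#|support_set (fun e => x e + eps * d e)%R| < #|support_set x|)%N \/
     exists U, tight_cut s t (fun e => x e + eps * d e) U].
Proof.
move=> fx cd ntight; have [e0 de0] := circulation_neg fx cd.
case: (fx) => x0 xl xv xU; case: (cd) => _ dx dv.
(* [inl] stands for the nonnegativity of an edge, [inr] for the constraint of an odd cut; [act]
   selects those whose slack decreases. *)
pose slack (c : E + {set V}) := match c with
  | inl e => x e | inr U => \sum_(e in cut_edges s t U) x e - 1 end.
pose slope (c : E + {set V}) := match c with
  | inl e => d e | inr U => \sum_(e in cut_edges s t U) d e end.
pose act (c : E + {set V}) :=
  (slope c < 0) && (if c is inr U then odd #|U| else true).
have act0 : act (inl e0) by rewrite /act /= de0.
(* The cuts of a vertex, of its complement and of the whole vertex set have slope 0, so an odd cut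
   that moves is nontrivial. *)
have Umid (U : {set V}) : odd #|U| -> \sum_(e in cut_edges s t U) d e != 0 ->
    (1 < #|U|)%N /\ (#|U|.+1 < #|V|)%N.
  move=> oU nz.
  have n1 : #|U| != 1%N by apply: contraNneq nz => /eqP/cards1P[v ->]; rewrite dv.
  have n2 : #|~: U| != 1%N.
    by apply: contraNneq nz => /eqP/cards1P[v Uv]; rewrite -cut_edgesC Uv dv.
  have n3 : #|~: U| != 0%N.
    apply: contraNneq nz => /eqP; rewrite cards_eq0 => /eqP U0.
    by rewrite -cut_edgesC U0 big1 // => e; rewrite !inE.
  by have := cardsC U; move: oU n1 n2 n3; move: #|U| #|~: U| #|V| => a b c; lia.
(* An edge with [d e < 0] is in the support, and no nontrivial odd cut is tight yet; hence the step
   length is positive. *)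
have slack_gt0 c : act c -> 0 < slack c.
  case: c => [e|U]; rewrite /act /=.
    by move=> /andP[de _]; rewrite lt0r x0 andbT; apply: contraTneq de => /dx->; rewrite ltxx.
  move=> /andP[dU oU]; have [U1 U2] := Umid U oU (ltr0_neq0 dU).
  rewrite subr_gt0 lt_neqAle xU // andbT; apply/eqP=> e1.
  by apply: (ntight U); split.
case: (@arg_minP _ _ _ (inl e0) act (fun c => slack c / - slope c) act0) => c ac cmin.
have nsl c' : act c' -> 0 < - slope c' by case/andP; rewrite oppr_gt0.
set eps := slack c / - slope c.
have eps0 : 0 < eps by rewrite divr_gt0 ?slack_gt0 ?nsl.
have lin (A : {set E}) : \sum_(e in A) (x e + eps * d e) =
    \sum_(e in A) x e + eps * \sum_(e in A) d e by rewrite big_split -mulr_sumr.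
have bound c' : act c' -> 0 <= slack c' + eps * slope c'.
  move=> ac'; have := cmin c' ac'; rewrite -/eps ler_pdivlMr ?nsl //.
  by rewrite mulrN lerNl -subr_ge0 opprK addrC [eps * _]mulrC mulrC.
exists eps; split=> //.
- split.
  + move=> e; case: (ltrP (d e) 0) => de; last by rewrite addr_ge0 // mulr_ge0 // ltW.
    by have := bound (inl e); rewrite /act /= de; apply.
  + by move=> e ste; rewrite xl // dx ?xl // mulr0 addr0.
  + by move=> v; rewrite lin dv xv mulr0 addr0.
  + move=> U oU; rewrite lin -subr_ge0 addrAC.
    case: (ltrP (\sum_(e in cut_edges s t U) d e) 0) => dU; last first.
      by rewrite addr_ge0 ?subr_ge0 ?xU // mulr_ge0 // ltW.
    by have := bound (inr U); rewrite /act /= dU oU; apply.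
- have tightc : slack c + eps * slope c = 0.
    rewrite /eps; have := nsl c ac; set a := slack c; set b := slope c => b0.
    by rewrite invrN mulrN mulNr mulfVK ?subrr // -oppr_eq0 gt_eqF.
  move: ac tightc (slack_gt0 c ac); rewrite {bound cmin nsl}.
  case: c @eps eps0 lin => [e|U] eps eps0 lin; rewrite /act /= => /andP[dc oU] tc sl.
    left; apply: proper_card; apply/properP; split.
      apply/subsetP=> f; rewrite !inE; apply: contraNneq => xf.
      by rewrite xf dx // mulr0 addr0.
    by exists e; rewrite inE ?tc ?eqxx // gt_eqF.
  right; exists U; have [U1 U2] := Umid U oU (ltr0_neq0 dc); split=> //.
  by apply/eqP; rewrite lin -subr_eq0 addrAC tc.
Qed.

Lemma circulationN (x d : E -> R) : circulation s t x d ->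
  circulation s t x (fun e => - d e).
Proof.
move=> [[e de] dx dv]; split.
- by exists e; rewrite oppr_eq0.
- by move=> f /dx->; rewrite oppr0.
- by move=> v; rewrite sumrN dv oppr0.
Qed.

(** With step lengths [a] along [d] and [b] against it, the weights b/(a+b) and a/(a+b) make the two
    moves cancel. *)
Lemma matching_hull_push (x d : E -> R) : fractional_matching s t x -> circulation s t x d ->
  (forall U, ~ tight_cut s t x U) ->
  (forall y : E -> R, fractional_matching s t y -> (#|support_set y| < #|support_set x|)%N \/
     (exists U, tight_cut s t y U) -> matching_hull s t y) ->
  matching_hull s t x.
Proof.
move=> fx cd nt IH.
have [a [a0 fa /(IH _ fa) ca]] := push_circulation fx cd nt.
have [b [b0 fb /(IH _ fb) cb]] := push_circulation fx (circulationN cd) nt.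
have ab0 : a + b != 0 by rewrite gt_eqF ?addr_gt0.
apply: (@matching_hull_convex _ _ _ _ _ _ _ _ (b / (a + b)) (a / (a + b)) _ _ _ ca cb).
- by rewrite divr_ge0 ?addr_ge0 // ltW.
- by rewrite divr_ge0 ?addr_ge0 // ltW.
- by field.
- by move=> e; field.
Qed.

End Push.

(** * Existence of a circulation *)

Section Kernel.
Variables (R : realFieldType) (E V : finType) (s t : E -> V).

(** The incidence matrix of the support has more rows than columns, hence a nonzero left kernel. *)
Lemma circulation_rank (x : E -> R) : (#|V| < #|support_set x|)%N ->
  exists d, circulation s t x d.
Proof.
set S := support_set x => VS.
pose A : 'M[R]_(#|S|, #|V|) :=
  \matrix_(i, j) (enum_val i \in cut_edges s t [set enum_val j])%:R.
have : kermx A != 0.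
  rewrite kermx_eq0 /row_free; apply: contraTneq (rank_leq_col A) => ->.
  by rewrite -ltnNge.
case/rowV0Pn=> u /sub_kermxP uA u0.
pose d e := \sum_i (enum_val i == e)%:R * u 0 i.
have dE (i : 'I_#|S|) : d (enum_val i) = u 0 i.
  rewrite /d (bigD1 i) //= eqxx mul1r big1 ?addr0 // => j ji.
  by rewrite (inj_eq enum_val_inj) (negbTE ji) mul0r.
have dS e : e \notin S -> d e = 0.
  move=> eS; rewrite /d big1 // => i _.
  case: eqP => [ie|]; last by rewrite mul0r.
  by rewrite -ie enum_valP in eS.
exists d; split.
- case: (pickP (fun i => u 0 i != 0)) => [i ui|none].
    by exists (enum_val i); rewrite dE.
  by case/eqP: u0; apply/rowP=> i; rewrite mxE; apply/eqP/negPn; rewrite none.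
- by move=> e xe; apply: dS; rewrite inE xe eqxx.
- move=> v; have := congr1 (fun B : 'rV_#|V| => B 0 (enum_rank v)) uA.
  rewrite !mxE => uAv; rewrite -[RHS]uAv /d.
  rewrite exchange_big /=; apply: eq_bigr => i _.
  rewrite mxE enum_rankK -mulr_suml mulrC; congr (_ * _).
  rewrite -natr_sum; congr _%:R.
  case: (boolP (enum_val i \in _)) => iv.
    by rewrite (bigD1 (enum_val i)) //= eqxx big1 ?addn0 // => e /andP[_ /negbTE]; rewrite eq_sym => ->.
  by rewrite big1 // => e eC; case: eqP => // ie; rewrite ie eC in iv.
Qed.

(** Counting edge ends gives 2|S| >= 3|V| for the support S, so it has more edges than vertices. *)
Lemma circulation_deg3 (x : E -> R) : (0 < #|V|)%N ->
  (forall e, x e != 0 -> s e != t e) ->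
  (forall v, 2 < #|support_set x :&: cut_edges s t [set v]|)%N ->
  exists d, circulation s t x d.
Proof.
move=> V0 nl deg3; apply: circulation_rank.
have : (\sum_v #|support_set x :&: cut_edges s t [set v]| = 2 * #|support_set x|)%N.
  transitivity (\sum_v \sum_(e in support_set x) ((s e == v) + (t e == v)))%N.
    apply: eq_bigr => v _; rewrite -sum1_card [LHS]big_mkcond [RHS]big_mkcond /=.
    apply: eq_bigr => e _; rewrite !inE; have [//|xe] := eqVneq (x e) 0.
    have := nl e xe; case: (eqVneq (s e) v) => [->|_]; case: (eqVneq (t e) v) => [te|_] //=.
  rewrite exchange_big /= (eq_bigr (fun=> 2%N)); first by rewrite sum_nat_const mulnC.
  move=> e _; rewrite big_split /= (bigD1 (s e)) //= eqxx big1 => [|v /negbTE]; last by rewrite eq_sym => ->.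
  by rewrite (bigD1 (t e)) //= eqxx big1 // => v /negbTE; rewrite eq_sym => ->.
have : (\sum_(v : V) 3 <= \sum_v #|support_set x :&: cut_edges s t [set v]|)%N by apply: leq_sum.
move=> h1 h2; move: h1; rewrite {}h2 sum_nat_const => h1.
have {}h1 : (#|V| * 3 <= 2 * #|support_set x|)%N by exact: h1.
by move: V0 h1; move: #|V| #|support_set x| => a b; lia.
Qed.

End Kernel.

Section Joins.
Variables (E V : finType) (s t : E -> V).

Definition joins (e : E) (a b : V) : bool :=
  ((s e == a) && (t e == b)) || ((s e == b) && (t e == a)).

Lemma joins_cut_edges e a b (U : {set V}) : joins e a b ->
  (e \in cut_edges s t U) = ((a \in U) != (b \in U)).
Proof. by case/orP=> /andP[/eqP sa /eqP tb]; rewrite inE sa tb // eq_sym. Qed.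

Lemma joins_cut_edges1 e a b y : a != b -> joins e a b ->
  (e \in cut_edges s t [set y]) = (y == a) || (y == b).
Proof.
move=> ab /joins_cut_edges->; rewrite !inE ![_ == y]eq_sym.
by have [->|_] := eqVneq y a; [rewrite (negbTE ab) | case: (y == b)].
Qed.

Lemma cut_edges1_joins e v : e \in cut_edges s t [set v] -> exists2 u, u != v & joins e v u.
Proof.
rewrite !inE /joins; have [sv|sv] := eqVneq (s e) v; have [tv|tv] := eqVneq (t e) v => // _.
  by exists (t e); rewrite ?eqxx.
by exists (s e); rewrite ?eqxx ?orbT.
Qed.

Lemma joinsC e a b : joins e a b = joins e b a.
Proof. by rewrite /joins orbC. Qed.

End Joins.

Section Exists.
Variables (R : realFieldType) (E V : finType) (s t : E -> V).

Lemma sum_delta (A : {set E}) e :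
  \sum_(f in A) ((f == e)%:R : R) = (e \in A)%:R.
Proof.
rewrite -natr_sum; congr _%:R; case: (boolP (e \in A)) => eA.
  by rewrite (bigD1 e) //= eqxx big1 ?addn0 // => f /andP[_ /negbTE->].
by rewrite big1 // => f fA; case: eqP => // fe; rewrite -fe fA in eA.
Qed.

Lemma circulation_parallel (x : E -> R) e f a b : a != b -> e != f ->
  x e != 0 -> x f != 0 -> joins s t e a b -> joins s t f a b ->
  exists d, circulation s t x d.
Proof.
move=> ab ef xe xf je jf; exists (fun g => (g == e)%:R - (g == f)%:R); split.
- by exists e; rewrite eqxx (negbTE ef) subr0 oner_eq0.
- move=> g xg.
  have ng l : x l != 0 -> (g == l) = false by apply: contraNF => /eqP<-; rewrite xg.
  by rewrite !ng // subr0.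
- by move=> v; rewrite sumrB !sum_delta !(joins_cut_edges1 _ ab je, joins_cut_edges1 _ ab jf) subrr.
Qed.

(** The signs alternate around the cycle [u], [v], [w], [z]. *)
Lemma circulation_4cycle (x : E -> R) e f g h u v w z :
  uniq [:: u; v; w; z] ->
  x e != 0 -> x f != 0 -> x g != 0 -> x h != 0 ->
  joins s t e u v -> joins s t f v w -> joins s t g u z -> joins s t h w z ->
  exists d, circulation s t x d.
Proof.
rewrite /= !inE !negb_or => /and4P[/and3P[uv uw uz] /andP[vw vz] wz _].
move=> xe xf xg xh je jf jg jh.
exists (fun k => (k == e)%:R - (k == f)%:R - (k == g)%:R + (k == h)%:R); split.
- exists e; rewrite eqxx.
  have nj k a b : joins s t k a b -> a != b -> ~~ (((a == u) || (b == u)) && ((a == v) || (b == v))) -> e == k = false.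
    move=> jk ab; apply: contraNF => /eqP ek; rewrite -ek in jk.
    by rewrite ![_ == u]eq_sym ![_ == v]eq_sym -!(joins_cut_edges1 _ ab jk) !(joins_cut_edges1 _ uv je) !eqxx orbT.
  rewrite (nj f v w) ?(nj g u z) ?(nj h w z) // ?subr0 ?addr0 ?oner_eq0 //.
  + by rewrite (eq_sym w u) (negbTE uw) (eq_sym z u) (negbTE uz).
  + by rewrite (eq_sym z v) (negbTE uv) (negbTE vz) andbF.
  + by rewrite (eq_sym v u) (negbTE uv) (eq_sym w u) (negbTE uw).
- move=> k xk.
  have nk l : x l != 0 -> (k == l) = false by apply: contraNF => /eqP<-; rewrite xk.
  by rewrite !nk // !subr0 addr0.
- move=> y; rewrite big_split /= !sumrB !sum_delta.
  rewrite (joins_cut_edges1 _ uv je) (joins_cut_edges1 _ vw jf) (joins_cut_edges1 _ uz jg) (joins_cut_edges1 _ wz jh).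
  have [->|_] := eqVneq y u; first by rewrite (negbTE uv) (negbTE uw) (negbTE uz) /=; ring.
  have [->|_] := eqVneq y v; first by rewrite (negbTE vw) (negbTE vz) /=; ring.
  have [->|_] := eqVneq y w; first by rewrite (negbTE wz) /=; ring.
  by rewrite /=; ring.
Qed.

Lemma fractional_matching_even (x : E -> R) : fractional_matching s t x -> ~~ odd #|V|.
Proof.
case=> _ _ _ xU; apply/negP=> oV; have := xU setT; rewrite cardsT => /(_ oV).
by rewrite big1 ?ler10 // => e; rewrite !inE.
Qed.

Lemma sum_support (x : E -> R) (A : {set E}) :
  \sum_(e in A) x e = \sum_(e in support_set x :&: A) x e.
Proof.
rewrite [LHS](bigID (mem (support_set x))) /= [X in _ + X]big1 ?addr0.
  by apply: eq_bigl => e; rewrite !inE andbC.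
by move=> e /andP[_]; rewrite inE negbK => /eqP.
Qed.

Lemma eq_sum_support (x : E -> R) (A B : {set E}) :
  (forall e, x e != 0 -> (e \in A) = (e \in B)) ->
  \sum_(e in A) x e = \sum_(e in B) x e.
Proof.
move=> AB; rewrite sum_support [RHS]sum_support; apply: eq_bigl => e; rewrite !inE.
by case: (eqVneq (x e) 0) => //= xe; rewrite AB.
Qed.

Lemma card_set3 (u v w : V) : u != v -> u != w -> v != w -> #|[set u; v; w]| = 3%N.
Proof.
by move=> uv uw vw; rewrite -setUA !cardsU1 cards1 !inE negb_or uv uw vw.
Qed.

Lemma second_edge (x : E -> R) y e : fractional_matching s t x -> e \in cut_edges s t [set y] ->
  x e != 1 -> exists f, [/\ f != e, f \in cut_edges s t [set y] & x f != 0].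
Proof.
case=> x0 xl xv xU ey xe1.
case: (pickP (fun f => [&& f != e, f \in cut_edges s t [set y] & x f != 0])) => [f /and3P[]|none].
  by exists f.
have := xv y; rewrite (bigD1 e) //= big1 ?addr0 => [xe|f /andP[fy fe]].
  by rewrite xe eqxx in xe1.
by have := none f; rewrite fe fy /= => /negbFE/eqP.
Qed.

Lemma edge_exhausts (x : E -> R) y e f : fractional_matching s t x -> x e = 1 ->
  e \in cut_edges s t [set y] -> f \in cut_edges s t [set y] -> x f != 0 -> f = e.
Proof.
case=> x0 xl xv xU xe1 ey fy xf; apply/eqP; apply: contraT => fe.
have := xv y; rewrite (bigD1 e) //= xe1 => /(canRL (addKr 1)); rewrite addNr.
move=> /psumr_eq0P h0; rewrite h0 ?eqxx // ?fy ?fe // in xf.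
Qed.

Lemma cut_edges1_support (x : E -> R) e y : fractional_matching s t x -> x e != 0 ->
  (e \in cut_edges s t [set y]) = (s e == y) || (t e == y).
Proof.
case=> _ xl _ _ xe; have st : s e != t e by apply: contraNneq xe => /xl->.
rewrite !inE; case: (eqVneq (s e) y) => [<-|_]; last by case: (t e == y).
by rewrite (eq_sym (t e)) (negbTE st).
Qed.

Lemma fourth_vertex_eq (u v w a b : V) : (#|V| < 5)%N -> uniq [:: u; v; w; a] ->
  b \notin [:: u; v; w] -> b = a.
Proof.
move=> V5 un bn; apply/eqP; apply: contraTT V5 => ba; rewrite -leqNgt.
have un2 : uniq [:: b; u; v; w; a].
  rewrite cons_uniq un andbT; move: bn; rewrite !inE (negbTE ba) !orbF.
  by rewrite !negb_or.
apply: (leq_trans _ (max_card [in [:: b; u; v; w; a]])).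
by rewrite (card_uniqP un2).
Qed.

(* If e = {u, v} has value 1, then {u, v, a} is tight for every third vertex a. *)
Lemma circulation_deg1 (x : E -> R) u v e e0 : fractional_matching s t x ->
  (forall U, ~ tight_cut s t x U) -> u != v -> joins s t e v u -> x e = 1 ->
  x e0 != 0 -> x e0 != 1 -> exists d, circulation s t x d.
Proof.
move=> fx nt uv je xe1 x00 x01; case: (fx) => x0 xl xv xU.
have vu : v != u by rewrite eq_sym.
have ecut y : (e \in cut_edges s t [set y]) = (y == v) || (y == u) := joins_cut_edges1 y vu je.
(* [e] uses up the whole weight at [u] and at [v], so every other support edge avoids both. *)
have off f : x f != 0 -> f != e -> (s f \notin [:: u; v]) && (t f \notin [:: u; v]).
  move=> xf fe; rewrite -negb_or; apply: contra fe.
  rewrite !inE => H; apply/eqP.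
  have [H1|H1] : f \in cut_edges s t [set u] \/ f \in cut_edges s t [set v].
  + by rewrite !(cut_edges1_support _ fx xf); case/orP: H => /orP[]->; rewrite ?orbT; auto.
  + by apply: edge_exhausts H1 xf => //; rewrite ecut eqxx orbT.
  + by apply: edge_exhausts H1 xf => //; rewrite ecut eqxx.
have ne0 : e0 != e by apply: contraNneq x01 => ->; rewrite xe1.
have ac : e0 \in cut_edges s t [set s e0] by rewrite (cut_edges1_support _ fx x00) eqxx.
have [b ba jab] := cut_edges1_joins ac; have ab : s e0 != b by rewrite eq_sym.
have [/= aoff boff] := andP (off e0 x00 ne0).
have {}boff : b \notin [:: u; v].
  by case/orP: jab => /andP[/eqP sa /eqP tb]; [rewrite -tb | rewrite -sa in ba *].
move: (s e0) ac ba jab ab aoff => a ac ba jab ab aoff.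
have [ua va] : u != a /\ v != a.
  by move: aoff; rewrite !inE negb_or ![a == _]eq_sym => /andP.
(* With five vertices or more the cut of {u, v, a} is nontrivial. Otherwise a second support edge at
   [a] must also end in [b], parallel to [e0]. *)
have [V5|V5] := ltnP 4 #|V|.
  case: (nt [set u; v; a]); split; rewrite ?card_set3 //.
  rewrite -(xv a); apply: eq_sum_support => f xf.
  have [->|fe] := eqVneq f e.
    by rewrite (joins_cut_edges _ je) ecut !inE !eqxx !orbT ![a == _]eq_sym (negbTE ua) (negbTE va).
  have := off f xf fe; rewrite !inE !negb_or => /andP[/andP[/negbTE-> /negbTE->] /andP[/negbTE-> /negbTE->]] //.
have [e1 [e10 e1a xe10]] := second_edge fx ac x01.
have [c ca jac] := cut_edges1_joins e1a.
have ne1 : e1 != e.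
  by apply: contraTneq e1a => ->; rewrite ecut ![a == _]eq_sym (negbTE ua) (negbTE va).
have coff : c \notin [:: u; v].
  have /andP[s1 t1] := off e1 xe10 ne1.
  by case/orP: jac => /andP[/eqP sa /eqP tb]; [rewrite -tb | rewrite -sa].
have cb : c = b.
  apply: (@fourth_vertex_eq u v a) => //.
  - rewrite /= !inE !negb_or uv ua va ab /=; move: boff; rewrite !inE negb_or ![b == _]eq_sym.
    by case/andP=> -> ->.
  - by move: coff; rewrite !inE !negb_or ca andbT.
rewrite cb in jac; rewrite eq_sym in e10.
exact: (circulation_parallel ab e10 x00 xe10 jab jac).
Qed.

Lemma sum_indicator (x : E -> R) (A : {set E}) :
  \sum_(e in A) x e = \sum_e x e * (e \in A)%:R.
Proof.
by rewrite big_mkcond; apply: eq_bigr => e _; case: ifP; rewrite ?mulr1 ?mulr0.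
Qed.

(* With u and w the neighbours of v, the cut of {u, v, w} has value at most
   (1 - x e) + (1 - x f) = 1, hence is tight. *)
Lemma circulation_deg2 (x : E -> R) v e f : fractional_matching s t x ->
  (forall U, ~ tight_cut s t x U) -> e != f ->
  support_set x :&: cut_edges s t [set v] = [set e; f] ->
  exists d, circulation s t x d.
Proof.
move=> fx nt ef Sv; case: (fx) => x0 xl xv xU.
have inS k : x k != 0 -> (k \in cut_edges s t [set v]) = (k == e) || (k == f).
  by move=> xk; rewrite -in_set2 -Sv in_setI /support_set in_set xk.
have : e \in [set e; f] by rewrite set21.
rewrite -Sv in_setI /support_set in_set => /andP[xe ev].
have : f \in [set e; f] by rewrite set22.
rewrite -Sv in_setI /support_set in_set => /andP[xf fv].
have xef : x e + x f = 1 by rewrite -(xv v) sum_support Sv big_setU1 ?inE //= big_set1.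
have xe1 : x e != 1 by apply: contraNneq xf => xe1; move/eqP: xef; rewrite xe1 addrC -subr_eq0 addrK.
have xf1 : x f != 1 by apply: contraNneq xe => xf1; move/eqP: xef; rewrite xf1 -subr_eq0 addrK.
have [u uv je] := cut_edges1_joins ev; have [w wv jf] := cut_edges1_joins fv.
have [vu vw] : v != u /\ v != w by rewrite ![v == _]eq_sym.
have [uw|uw] := eqVneq u w.
  by rewrite -uw in jf; apply: (circulation_parallel vu ef xe xf je jf).
have cute := joins_cut_edges1 _ vu je; have cutf := joins_cut_edges1 _ vw jf.
pose U := [set u; v; w]; have U3 : #|U| = 3%N by rewrite card_set3.
pose J := [set k | joins s t k u w].
(* Edge by edge, the sums at [u] and [w] together give the cut of [U], twice the edges between [u]
   and [w], and the sum at [v], whose only edges are [e] and [f]. *)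
have id k : x k * (k \in cut_edges s t U)%:R + 2 * (x k * (k \in J)%:R)
    + x k * (k \in cut_edges s t [set v])%:R =
    x k * (k \in cut_edges s t [set u])%:R + x k * (k \in cut_edges s t [set w])%:R.
  have [->|xk] := eqVneq (x k) 0; first by rewrite !mul0r mulr0 !addr0.
  have nJ l : l \in cut_edges s t [set v] -> (l \in J) = false.
    apply: contraTF; rewrite inE => jl; rewrite (joins_cut_edges1 _ uw jl).
    by rewrite (negbTE vu) (negbTE vw).
  have [->|ke] := eqVneq k e.
    rewrite nJ // (joins_cut_edges _ je) !cute !inE !eqxx !orbT.
    by rewrite (negbTE vu) (eq_sym w u) (negbTE uw) (eq_sym w v) (negbTE vw) /=; ring.
  have [->|kf] := eqVneq k f.
    rewrite nJ // (joins_cut_edges _ jf) !cutf !inE !eqxx !orbT.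
    by rewrite (negbTE vw) (negbTE uw) (eq_sym u v) (negbTE vu) /=; ring.
  have := inS k xk; rewrite (negbTE ke) (negbTE kf) /= => kv; rewrite kv.
  move: kv; rewrite !(cut_edges1_support _ fx xk) => /negbT; rewrite negb_or => /andP[/negbTE sv /negbTE tv].
  have st : s k != t k by apply: contraNneq xk => /xl->.
  rewrite !inE sv tv /joins !orbF.
  have [su|su] := eqVneq (s k) u; have [tu|tu] := eqVneq (t k) u;
  have [sw|sw] := eqVneq (s k) w; have [tw|tw] := eqVneq (t k) w => /=;
    try ring.
  all: try (by move: st; rewrite su tu eqxx).
  all: try (by move: st; rewrite sw tw eqxx).
  all: try (by move: uw; rewrite -su -sw eqxx).
  all: try (by move: uw; rewrite -tu -tw eqxx).
have : \sum_(k in cut_edges s t U) x k + 2 * \sum_(k in J) x k + 1 = 2.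
  transitivity (\sum_(k in cut_edges s t [set u]) x k + \sum_(k in cut_edges s t [set w]) x k).
    2: by rewrite !xv.
  rewrite -[X in _ + _ + X](xv v) !sum_indicator mulr_sumr -!big_split.
  by apply: eq_bigr => k _ /=; apply: id.
have J0 : 0 <= \sum_(k in J) x k by apply: sumr_ge0.
have U1 : 1 <= \sum_(k in cut_edges s t U) x k by apply: xU; rewrite U3.
move=> eq2; have Ue : \sum_(k in cut_edges s t U) x k = 1 by lra.
have Je : \sum_(k in J) x k = 0 by lra.
(* On at most four vertices the second edges at [u] and [w] both end in the fourth vertex and close
   a 4-cycle. *)
have [V5|V5] := ltnP 4 #|V|; first by case: (nt U); split=> //; rewrite U3.
have eu : e \in cut_edges s t [set u] by rewrite cute eqxx orbT.
have fw : f \in cut_edges s t [set w] by rewrite cutf eqxx orbT.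
have [g [ge gu xg]] := second_edge fx eu xe1.
have [h [hf hw xh]] := second_edge fx fw xf1.
have [z zu jg] := cut_edges1_joins gu; have [z' zw jh] := cut_edges1_joins hw.
have nJ k : x k != 0 -> ~~ joins s t k u w.
  apply: contra => jk; have /psumr_eq0P := Je; move=> -> //; by rewrite inE.
have zv : z != v.
  apply/eqP=> zv; rewrite zv in jg; have := inS g xg.
  rewrite (joins_cut_edges1 _ uv jg) eqxx orbT (negbTE ge) /= => /esym/eqP gf.
  by move: gu; rewrite gf cutf (eq_sym u v) (negbTE vu) (negbTE uw).
have zw2 : z != w by apply: contraTneq jg => ->; apply: nJ.
have zv' : z' != v.
  apply/eqP=> zv'; rewrite zv' in jh; have := inS h xh.
  rewrite (joins_cut_edges1 _ wv jh) eqxx orbT (negbTE hf) orbF /= => /esym/eqP he.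
  by move: hw; rewrite he cute (eq_sym w v) (negbTE vw) (eq_sym w u) (negbTE uw).
have zu' : z' != u by apply: contraTneq jh => ->; rewrite joinsC; apply: nJ.
have un : uniq [:: u; v; w; z].
  by rewrite /= !inE !negb_or uv uw vw ![_ == z]eq_sym zu zv zw2.
have zz : z' = z by apply: (fourth_vertex_eq V5 un); rewrite !inE !negb_or zu' zv' zw.
rewrite zz in jh; rewrite joinsC in je.
exact: (circulation_4cycle un xe xf xg xh je jf jg jh).
Qed.

(** By support degrees: degree 0 contradicts the vertex sum 1, degree 1 means an edge of value 1,
    degree 2 is treated separately, and if all degrees are at least 3 the dimension count
    applies. *)
Lemma circulation_exists (x : E -> R) e0 : fractional_matching s t x ->
  (forall U, ~ tight_cut s t x U) -> x e0 != 0 -> x e0 != 1 ->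
  exists d, circulation s t x d.
Proof.
move=> fx nt x00 x01; case: (fx) => x0 xl xv xU.
have nl e : x e != 0 -> s e != t e by apply: contraNneq => /xl->.
case: (pickP (fun v => #|support_set x :&: cut_edges s t [set v]| <= 2)%N) => [v|none].
  move: {-2}(#|_|) (erefl #|support_set x :&: cut_edges s t [set v]|) => [|[|[|k]]] //.
  - move/esym/eqP; rewrite cards_eq0 => /eqP Sv _; have := xv v.
    by rewrite sum_support Sv big_set0 => /eqP; rewrite eq_sym oner_eq0.
  - move/esym/eqP/cards1P=> [e Sv] _.
    have : e \in [set e] by rewrite set11.
    rewrite -Sv in_setI => /andP[_ /cut_edges1_joins[u uv je]].
    apply: (circulation_deg1 fx nt uv je _ x00 x01).
    by rewrite -(xv v) sum_support Sv big_set1.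
  - move/esym/eqP/cards2P=> [e [f [ef Sv]]] _.
    exact: (circulation_deg2 fx nt ef Sv).
apply: circulation_deg3 => //; last by move=> v; rewrite ltnNge none.
by apply/card_gt0P; exists (s e0).
Qed.

Lemma matching_hull_integral (x : E -> R) : fractional_matching s t x ->
  (forall e, x e = 0 \/ x e = 1) -> matching_hull s t x.
Proof.
case=> x0 xl xv xU x01; exists (fun P => (P == support_set x)%:R); split.
- by move=> P; rewrite ler0n.
- move=> P; rewrite pnatr_eq0 eqb0 negbK => /eqP-> v.
  have := xv v; rewrite sum_support (eq_bigr (fun=> 1)) => [|e].
    by rewrite sumr_const => /eqP; rewrite (eqr_nat R _ 1) => /eqP.
  by rewrite !inE => /andP[xe _]; case: (x01 e) => // xe0; rewrite xe0 eqxx in xe.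
- by rewrite (bigD1 (support_set x)) //= eqxx big1 ?addr0 // => P /negbTE->.
- move=> e; rewrite -natr_sum.
  case: (x01 e) => xe.
    rewrite xe big1 // => P eP; case: eqP => // PS.
    by rewrite PS inE xe eqxx in eP.
  rewrite xe (bigD1 (support_set x)) /= ?inE ?xe ?oner_eq0 // eqxx big1 //.
  by move=> P /andP[_ /negbTE->].
Qed.

End Exists.

(* Edmonds' theorem, by induction on the number of vertices and then on the
   support.  A nontrivial tight odd cut allows gluing matchings of the two
   contractions along their common cut edge.  Without one, a circulation (a
   signed vector with zero sum at every vertex) lets x move in both directions
   until an edge vanishes or an odd cut becomes tight. *)
Theorem perfect_matching_polytope (R : realFieldType) (E V : finType)
  (s t : E -> V) (x : E -> R) : fractional_matching s t x -> matching_hull s t x.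
Proof.
move: {-1}#|V| (leqnn #|V|) => N; elim: N V s t x => [|N IHN] V s t x VN fx.
  apply: matching_hull_integral => // e.
  suff : (0 < #|V|)%N by rewrite ltnNge VN.
  by apply/card_gt0P; exists (s e).
(* Both contractions at a nontrivial tight cut have fewer vertices; the other shore is odd as well
   because |V| is even. *)
have tightP (y : E -> R) : fractional_matching s t y -> (exists U, tight_cut s t y U) -> matching_hull s t y.
  move=> fy [U [oU U1 UV yU]].
  have UC := cardsC U; have eV := fractional_matching_even fy.
  apply: (glue fy yU).
  - apply: IHN; first by rewrite card_collapse; lia.
    exact: fractional_matching_collapse.
  - apply: IHN; first by rewrite card_collapse; lia.
    apply: fractional_matching_collapse => //; last by rewrite cut_edgesC.
    by move: eV; rewrite -UC oddD oU; case: (odd _).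
move: {-1}#|support_set x| (leqnn #|support_set x|) => M; elim: M x fx => [|M IHM] x fx SM.
  by apply: matching_hull_integral => // e; left; apply/eqP; apply: contraTT SM => xe; rewrite -ltnNge; apply/card_gt0P; exists e; rewrite inE.
case: (pickP (fun e => (x e != 0) && (x e != 1))) => [e /andP[xe0 xe1]|int]; last first.
  apply: matching_hull_integral => // e; have := int e.
  by case: eqP => [|_]; [left | case: eqP => // ->; right].
case: (pickP (fun U : {set V} => [&& odd #|U|, (1 < #|U|)%N, (#|U|.+1 < #|V|)%N
    & \sum_(e in cut_edges s t U) x e == 1])) => [U /and4P[oU U1 UV /eqP xU]|nt].
  by apply: tightP => //; exists U; split.
have {}nt U : ~ tight_cut s t x U.
  by case=> oU U1 UV xU; have := nt U; rewrite oU U1 UV xU eqxx.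
have [d cd] := circulation_exists fx nt xe0 xe1.
apply: (matching_hull_push fx cd nt) => y fy [yS|yt]; last exact: tightP.
by apply: IHM => //; rewrite -ltnS (leq_trans yS).
Qed.

(** * Squares and Hamiltonian cycles *)

Section Edges.
Variable n : nat.
Implicit Types (e : edge n) (u v i j : 'I_n) (U : {set 'I_n}).

Lemma edge_neq e : (val e).1 != (val e).2.
Proof. by rewrite -val_eqE neq_ltn (valP e). Qed.

Lemma is_edgeC i j e : is_edge i j e = is_edge j i e.
Proof. by rewrite /is_edge orbC. Qed.

Lemma is_edge_self e : is_edge (val e).1 (val e).2 e.
Proof. by rewrite /is_edge !eqxx. Qed.

Lemma is_edge_neq i j e : is_edge i j e -> i != j.
Proof. by have := edge_neq e => /[swap] /orP[]/andP[/eqP-> /eqP->]; rewrite // eq_sym. Qed.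

Lemma is_edge_exists i j : i != j -> exists e, is_edge i j e.
Proof.
rewrite -val_eqE neq_ltn => /orP[] lt.
  by exists (exist _ (i, j) lt); rewrite /is_edge !eqxx.
by exists (exist _ (j, i) lt); rewrite /is_edge !eqxx orbT.
Qed.

Lemma is_edge_inj i j e f : is_edge i j e -> is_edge i j f -> e = f.
Proof.
move=> he hf; apply: val_inj; move: (valP e) (valP f) he hf.
rewrite /is_edge; case: (val e) (val f) => [a b] [c d] /=.
move=> ab cd /orP[]/andP[/eqP ? /eqP ?] /orP[]/andP[/eqP ? /eqP ?]; subst=> //;
by have := ltn_trans ab cd; rewrite ltnn.
Qed.

Lemma incident_is_edge v u e : is_edge v u e -> incident v e.
Proof. by case/orP=> /andP[/eqP a /eqP b]; rewrite /incident a b eqxx ?orbT. Qed.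

Lemma incidentP v e : incident v e -> exists u, is_edge v u e.
Proof.
case/orP=> /eqP->; first by exists (val e).2; apply: is_edge_self.
by exists (val e).1; rewrite is_edgeC is_edge_self.
Qed.

Lemma in_cut_edge i j e U : is_edge i j e -> in_cut U e = ((i \in U) != (j \in U)).
Proof. by case/orP=> /andP[/eqP<- /eqP<-]; rewrite /in_cut // eq_sym. Qed.

Lemma in_cut1 v e : in_cut [set v] e = incident v e.
Proof.
rewrite /in_cut /incident !inE ![_ == v]eq_sym; have := edge_neq e.
by case: (eqVneq v (val e).1) => [<-|_]; case: (eqVneq v (val e).2).
Qed.

Lemma sum_degree (f : edge n -> nat) U :
  (\sum_(v in U) degree f v =
   \sum_e f e * (((val e).1 \in U) + ((val e).2 \in U)))%N.
Proof.
rewrite /degree (exchange_big_dep predT) //=; apply: eq_bigr => e _.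
have pick a : (\sum_v (v == a) * (v \in U) = (a \in U))%N.
  by rewrite (bigD1 a) //= eqxx mul1n big1 ?addn0 // => v /negbTE->.
rewrite -(pick (val e).1) -(pick (val e).2) -big_split big_distrr big_mkcond /=.
apply: eq_bigr => v _; have := edge_neq e; rewrite /incident.
case: (v \in U); rewrite /= ?muln0 // !muln1.
have [<-|_] := eqVneq v (val e).1; have [|_] := eqVneq v (val e).2 => //= *;
by rewrite ?addn0 ?muln1 ?muln0.
Qed.

(** An edge inside [U] is counted twice on the left, one outside not at all. *)
Lemma handshake (f : edge n -> nat) U :
  odd (\sum_(v in U) degree f v) = odd (\sum_(e | in_cut U e) f e).
Proof.
rewrite sum_degree [in RHS]big_mkcond /=.
elim/big_rec2: _ => // e a b _; rewrite !oddD => ->; congr (_ (+) _).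
by rewrite /in_cut; case: (_ \in U); case: (_ \in U) => /=; rewrite ?muln0 ?muln1 ?oddM ?andbF.
Qed.

Lemma degree_eq1 (f : edge n -> nat) v u e : is_edge v u e -> f e = 1%N ->
  (forall u' g, is_edge v u' g -> u' != u -> f g = 0%N) -> degree f v = 1%N.
Proof.
move=> ve fe f0; rewrite /degree (bigD1 e) ?(incident_is_edge ve) //= fe big1 //.
move=> g /andP[/incidentP[u' vg] ge]; apply: (f0 u') => //.
by apply: contraNneq ge => uu; rewrite uu in vg; apply/eqP/(is_edge_inj vg ve).
Qed.

Lemma adjC (m : edge n -> nat) : symmetric (adj m).
Proof. by move=> i j; rewrite /adj; apply: eq_existsb => e; rewrite is_edgeC. Qed.

Lemma connect_adjC (m : edge n -> nat) : connect_sym (adj m).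
Proof. exact: sym_connect_sym (adjC m). Qed.

Lemma adj_edge (m : edge n -> nat) i j e : is_edge i j e -> (0 < m e)%N -> adj m i j.
Proof. by move=> ie me; apply/existsP; exists e; rewrite me ie. Qed.

End Edges.

(* p and q are the two perfect matchings of every 4-cycle of H_x, given as
   commuting fixed-point-free involutions of the vertices in sq. *)
Definition square_matchings (R : numFieldType) n (x : edge n -> R)
    (sq : pred 'I_n) (p q : 'I_n -> 'I_n) : Prop :=
  (forall v, sq v -> [/\ sq (p v), p (p v) = v, p v != v & p v != q v]) /\
  (forall v, sq v -> [/\ sq (q v), q (q v) = v, q v != v & q (p v) = p (q v)]) /\
  (forall i j e, is_edge i j e ->
     in_H x e = sq i && ((j == p i) || (j == q i))).

(** Only the smaller end is tested; as [p] is an involution on [sq], the test at the other end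
    agrees ([matchedE]). *)
Definition matched n (sq : pred 'I_n) (p : 'I_n -> 'I_n) (e : edge n) : bool :=
  sq (val e).1 && ((val e).2 == p (val e).1).

Section Square.
Variables (R : numFieldType) (n : nat) (x : edge n -> R) (sq : pred 'I_n).

Lemma square_matchingsC p q :
  square_matchings x sq p q -> square_matchings x sq q p.
Proof.
move=> [hp [hq hH]]; split; last split.
- by move=> v sv; have [? ? ? ?] := hp v sv; have [? ? ? ?] := hq v sv; split; rewrite // eq_sym.
- by move=> v sv; have [? ? ? ?] := hp v sv; have [? ? ? ?] := hq v sv; split.
- by move=> i j e ie; rewrite (hH i j e ie) orbC.
Qed.

Lemma matchedE p q i j e : square_matchings x sq p q -> is_edge i j e ->
  matched sq p e = sq i && (j == p i).
Proof.
move=> [hp _]; rewrite /matched => /orP[]/andP[/eqP-> /eqP->] //.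
by apply/andP/andP=> -[s /eqP E]; have [s1 s2 _ _] := hp _ s; rewrite E s2.
Qed.

Lemma in_H_matched p q e : square_matchings x sq p q ->
  in_H x e = matched sq p e || matched sq q e.
Proof. by move=> [_ [_ hH]]; rewrite (hH _ _ _ (is_edge_self e)) andb_orr. Qed.

Lemma matched_disj p q e : square_matchings x sq p q ->
  matched sq p e -> ~~ matched sq q e.
Proof.
move=> [hp _] /andP[s /eqP e2]; rewrite /matched s e2 /=.
by have [_ _ _] := hp _ s.
Qed.

Lemma in_WH e : in_W x e -> ~~ in_H x e.
Proof.
by rewrite /in_W /in_H => /eqP->; rewrite mul1r eq_sym invr_eq1 (eqr_nat _ 2 1).
Qed.

Lemma in_W_matched p q e : square_matchings x sq p q -> in_W x e ->
  matched sq p e = false.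
Proof.
by move=> S /in_WH; rewrite (in_H_matched e S) negb_or => /andP[/negbTE].
Qed.

Lemma degree_matched p q v : square_matchings x sq p q ->
  degree (fun e => matched sq p e : nat) v = sq v.
Proof.
move=> S; case: (boolP (sq v)) => sv.
  have [[_ _ pv _] _] := (proj1 S v sv, tt).
  have [e ve] : exists e, is_edge v (p v) e by apply: is_edge_exists; rewrite eq_sym.
  apply: (degree_eq1 ve); first by rewrite (matchedE S ve) sv eqxx.
  by move=> u' g vg /negbTE nu; rewrite (matchedE S vg) nu andbF.
rewrite /degree big1 // => e /incidentP[u vu].
by rewrite (matchedE S vu) (negbTE sv).
Qed.

Lemma half_value e : (x e = 0 \/ x e = 1 / 2 \/ x e = 1) ->
  x e = (in_W x e)%:R + (in_H x e)%:R / 2.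
Proof.
move=> half; move: (@in_WH e); rewrite /in_W /in_H.
case: half => [->|[->|->]].
- rewrite [0 == 1]eq_sym oner_eq0 [0 == _]eq_sym mul1r invr_eq0 pnatr_eq0 /= => _.
  by rewrite mul0r addr0.
- rewrite eqxx; case: eqP => _; first by move/(_ isT).
  by rewrite add0r.
- by rewrite eqxx => /(_ isT)/negbTE->; rewrite mul0r addr0.
Qed.

(** The values at [v] sum to 2, and at a square vertex the two half-edges contribute 1 of this. *)
Lemma degree_W p q v : (forall e, x e = 0 \/ x e = 1 / 2 \/ x e = 1) ->
  square_matchings x sq p q -> in_SUBT x ->
  degree (fun e => in_W x e : nat) v = if sq v then 1%N else 2%N.
Proof.
move=> half S [_ [/(_ v) deg2 _]]; move: deg2.
rewrite /cut_sum (eq_bigl _ _ (in_cut1 v)).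
rewrite (eq_bigr (fun e => (in_W x e)%:R +
   ((matched sq p e)%:R + (matched sq q e)%:R) / 2)); last first.
  move=> e _; rewrite (half_value (half e)) (in_H_matched e S); congr (_ + _ / 2).
  have := @matched_disj p q e S; case: (matched sq p e) => /=; rewrite ?add0r //.
  by move=> /(_ isT)/negbTE->; rewrite addr0.
rewrite big_split -mulr_suml big_split /= -!natr_sum.
have := degree_matched v S; rewrite /degree => ->.
have := degree_matched v (square_matchingsC S); rewrite /degree => ->.
case: (sq v).
  rewrite -natrD divff ?pnatr_eq0 // => /eqP.
  by rewrite -(natrD _ _ 1) eqr_nat addn1 eqSS => /eqP.
by rewrite !add0r mul0r addr0 => /eqP; rewrite eqr_nat => /eqP.
Qed.

End Square.

(** By [degree_W] and [degree_matched] all degrees are 2, so connectedness makes this a Hamiltonian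
    cycle. *)
Definition two_factor (R : numFieldType) n (x : edge n -> R) (sq : pred 'I_n)
    (p : 'I_n -> 'I_n) (e : edge n) : nat := (in_W x e + matched sq p e)%N.

(** * Switching the two matchings of a square *)

Section Switch.
Variables (R : numFieldType) (n : nat) (x : edge n -> R) (sq : pred 'I_n).
Variables (p q : 'I_n -> 'I_n).

Definition square (a : 'I_n) : {set 'I_n} := [set a; p a; q a; p (q a)].

Lemma square_q a : square_matchings x sq p q -> sq a -> square (q a) = square a.
Proof.
move=> [hp [hq _]] sa; have [sqa qqa _ qpa] := hq a sa.
apply/setP=> v; rewrite !inE qqa.
by case: (v == a); case: (v == p a); case: (v == q a); case: (v == p (q a)).
Qed.

Lemma square_card a : square_matchings x sq p q -> sq a ->
  uniq [:: a; p a; q a; p (q a)].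
Proof.
move=> [hp [hq _]] sa; have [spa ppa pa pq] := hp a sa; have [sqa qqa qa qpa] := hq a sa.
have [_ _ pqa pqqa] := hp _ sqa; rewrite qqa in pqqa.
rewrite /= !inE !negb_or ![a == _]eq_sym pa qa pqqa pq [q a == _]eq_sym pqa !andbT /=.
have [_ ppqa _ _] := hp _ sqa.
by apply: contraNneq qa => /(congr1 p); rewrite ppa ppqa => <-.
Qed.

Lemma card_square a : square_matchings x sq p q -> sq a -> #|square a| = 4%N.
Proof.
move=> S sa; have /card_uniqP/= <- := square_card S sa.
by apply: eq_card => v; rewrite !inE -!orbA.
Qed.

Lemma square_sq a v : square_matchings x sq p q -> sq a -> v \in square a -> sq v.
Proof.
move=> [hp [hq _]] sa; have [spa _ _ _] := hp a sa; have [sqa _ _ _] := hq a sa.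
have [spqa _ _ _] := hp _ sqa.
by rewrite !inE -!orbA => /or4P[]/eqP->.
Qed.

Lemma square_closed a v : square_matchings x sq p q -> sq a -> sq v ->
  ((p v \in square a) = (v \in square a)) * ((q v \in square a) = (v \in square a)).
Proof.
move=> [hp [hq _]] sa sv.
have [spa ppa pa pq] := hp a sa; have [sqa qqa qa qpa] := hq a sa.
have [spqa ppqa _ _] := hp _ sqa; have [_ _ _ qpqa] := hq _ sqa.
have [_ ppv _ _] := hp v sv; have [_ qqv _ _] := hq v sv.
have sub u : u \in square a -> (p u \in square a) /\ (q u \in square a).
  rewrite !inE -!orbA => /or4P[]/eqP->;
  by rewrite ?ppa ?qqa ?ppqa ?qpqa ?qpa ?qqa ?eqxx ?orbT.
by split; apply/idP/idP=> /sub[] //; rewrite ?ppv ?qqv.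
Qed.

Definition switch (a v : 'I_n) : 'I_n := if v \in square a then q v else p v.

Lemma switch_spec a v : square_matchings x sq p q -> sq a -> sq v ->
  let p' := switch a in let q' := fun v => if v \in square a then p v else q v in
  [/\ sq (p' v), p' (p' v) = v, p' v != v & p' v != q' v] /\
  [/\ sq (q' v), q' (q' v) = v, q' v != v & q' (p' v) = p' (q' v)].
Proof.
move=> S sa sv; case: (S) => hp [hq _].
have [spv ppv pv pqv] := hp v sv; have [sqv qqv qv qpv] := hq v sv.
have cl := square_closed S sa sv.
rewrite /= /switch; case: (boolP (v \in square a)) => va.
  by rewrite !cl va /=; split; split=> //; rewrite eq_sym.
by rewrite !cl (negbTE va).
Qed.

Lemma switch_matchings a : square_matchings x sq p q -> sq a ->
  square_matchings x sq (switch a) (fun v => if v \in square a then p v else q v).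
Proof.
move=> S sa; split; last split.
- by move=> v sv; have [] := switch_spec S sa sv.
- by move=> v sv; have [] := switch_spec S sa sv.
- move=> i j e ie; case: (S) => _ [_ hH]; rewrite (hH i j e ie) /switch.
  by case: (i \in square a); rewrite // orbC.
Qed.

(** The 2-factor without the two [p]-edges of the square at [a]; it is contained in the 2-factors
    before and after the switch. *)
Definition cut_factor (a : 'I_n) (e : edge n) : nat :=
  (in_W x e + (matched sq p e && ((val e).1 \notin square a)))%N.

Lemma cut_factorE a i j e : square_matchings x sq p q -> sq a -> is_edge i j e ->
  cut_factor a e = (in_W x e + [&& sq i, j == p i & i \notin square a])%N.
Proof.
move=> S sa ie; rewrite /cut_factor (matchedE S ie) -andbA; congr (_ + nat_of_bool _)%N.
case: (boolP (sq i)) => //= si; case: eqP => //= jp.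
case/orP: ie => /andP[/eqP i1 /eqP i2]; rewrite i1 //.
by rewrite jp (square_closed S sa si).
Qed.

Lemma odd_degree_cut_factor a v : (forall e, x e = 0 \/ x e = 1 / 2 \/ x e = 1) ->
  square_matchings x sq p q -> in_SUBT x -> sq a ->
  odd (degree (cut_factor a) v) = (v \in square a).
Proof.
move=> half S sub sa; rewrite /degree big_split oddD /=.
have := degree_W v half S sub; rewrite /degree => ->.
case: (boolP (v \in square a)) => va.
  rewrite (square_sq S sa va) big1 // => e /incidentP[u vu].
  rewrite (matchedE S vu); case: eqP => [up|]; last by rewrite andbF.
  rewrite (square_sq S sa va) /=; case/orP: vu => /andP[/eqP-> _]; first by rewrite va.
  by rewrite up (square_closed S sa (square_sq S sa va)) va.
rewrite (eq_bigr (fun e => matched sq p e : nat)); last first.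
  move=> e /incidentP[u vu]; rewrite (matchedE S vu).
  case: (boolP (sq v)) => //= sv; case: eqP => //= up.
  case/orP: vu => /andP[/eqP-> _]; first by rewrite va.
  by rewrite up (square_closed S sa sv) va.
by have := degree_matched v S; rewrite /degree => ->; case: (sq v).
Qed.

(* Deleting the two edges of a square that lie in different components leaves
   a graph whose odd vertices are the four corners, so by parity the ends of
   each deleted edge remain connected. *)
Lemma cut_factor_connect a : (forall e, x e = 0 \/ x e = 1 / 2 \/ x e = 1) ->
  square_matchings x sq p q -> in_SUBT x -> sq a ->
  ~~ connect (adj (two_factor x sq p)) a (q a) ->
  connect (adj (cut_factor a)) a (p a).
Proof.
move=> half S sub sa nc; case: (S) => hp [hq hH].
pose X := [set v | connect (adj (cut_factor a)) a v].
have aX : a \in X by rewrite inE connect0.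
have cutX : \sum_(e | in_cut X e) cut_factor a e = 0%N :> nat.
  apply: big1 => e; have ie := is_edge_self e; rewrite (in_cut_edge _ ie) => ce.
  apply/eqP; rewrite -leqn0 leqNgt; apply: contra ce => pe; rewrite !inE.
  have a1 := adj_edge ie pe; rewrite is_edgeC in ie; have a2 := adj_edge ie pe.
  by apply/eqP; apply/idP/idP=> h; apply: connect_trans h (connect1 _).
have sX : subrel (connect (adj (cut_factor a))) (connect (adj (two_factor x sq p))).
  apply: connect_sub => u v /existsP[e /andP[pe ie]]; apply/connect1/(adj_edge ie).
  by apply: leq_trans pe _; rewrite /two_factor leq_add2l; case: (matched _ _ _); case: (_ \in _).
have [sqa _ _ _] := hq a sa; have [spqa ppqa pqa _] := hp _ sqa.
have qaX : q a \notin X by rewrite inE; apply: contra nc => /sX.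
have pqaX : p (q a) \notin X.
  rewrite inE; apply: contra nc => /sX h; apply: connect_trans h (connect1 _).
  have [e ie] := is_edge_exists pqa.
  by apply: (adj_edge ie); rewrite /two_factor (matchedE S ie) spqa ppqa eqxx addn1.
(* No edge leaves [X], so it contains an even number of odd vertices. As [q a] and [p (q a)] are
   outside, [a] cannot be the only corner in it. *)
have := handshake (cut_factor a) X; rewrite cutX /=.
apply: contraFT => pX.
have -> : odd (\sum_(v in X) degree (cut_factor a) v)
   = odd (\sum_(v in X) (v \in square a)).
  by elim/big_rec2: _ => // v m k _ h; rewrite !oddD h (odd_degree_cut_factor v half S sub sa) oddb.
rewrite (bigD1 a) //= big1 ?addn0; first by rewrite !inE eqxx.
move=> v /andP[vX va]; rewrite !inE (negbTE va) /=.
by apply/eqP; rewrite eqb0 !negb_or -!andbA; apply/and3P; split; apply: contraTneq vX => ->; rewrite // inE.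
Qed.

End Switch.

Section Hamiltonian.
Variables (R : numFieldType) (n : nat) (x : edge n -> R) (sq : pred 'I_n).

(** The ends of both removed [p]-edges stay connected without them, by [cut_factor_connect] at [a]
    and at [q a], so no connection is lost; the new edge joins [a] to [q a]. *)
Lemma switch_connect p q a : (forall e, x e = 0 \/ x e = 1 / 2 \/ x e = 1) ->
  square_matchings x sq p q -> in_SUBT x -> sq a ->
  ~~ connect (adj (two_factor x sq p)) a (q a) ->
  subrel (connect (adj (two_factor x sq p)))
    (connect (adj (two_factor x sq (switch p q a)))) /\
  connect (adj (two_factor x sq (switch p q a))) a (q a).
Proof.
move=> half S sub sa nc; case: (S) => hp [hq hH].
have S' := switch_matchings S sa.
have sX : subrel (connect (adj (cut_factor x sq p q a)))
    (connect (adj (two_factor x sq (switch p q a)))).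
  apply: connect_sub => u v /existsP[e /andP[pe ie]]; apply/connect1/(adj_edge ie).
  apply: leq_trans pe _; rewrite (cut_factorE S sa ie) /two_factor leq_add2l.
  by rewrite (matchedE S' ie) /switch; case: (sq u) => //; case: (u \in _); rewrite /= ?andbF ?andbT.
have [sqa qqa qa qpa] := hq a sa; have [_ _ pqa _] := hp _ sqa.
have c1 := sX _ _ (cut_factor_connect half S sub sa nc).
have nc2 : ~~ connect (adj (two_factor x sq p)) (q a) (q (q a)).
  by rewrite qqa (connect_adjC _ (q a)).
have := cut_factor_connect half S sub sqa nc2.
rewrite /cut_factor (square_q S sa) -/(cut_factor x sq p q a) => /sX c2.
split.
  apply: connect_sub => u v /existsP[e /andP[pe ie]].
  case: (boolP (0 < cut_factor x sq p q a e)%N) => ce.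
    by apply: sX; apply/connect1/(adj_edge ie).
  move: pe ce; rewrite (cut_factorE S sa ie) /two_factor (matchedE S ie).
  case: (in_W x e) => //=; rewrite !add0n !lt0b => /andP[su /eqP ->].
  rewrite su eqxx /= negbK !inE -!orbA => /or4P[]/eqP->.
  - exact: c1.
  - by have [_ -> _ _] := hp a sa; rewrite connect_adjC.
  - exact: c2.
  - by have [_ -> _ _] := hp _ sqa; rewrite connect_adjC.
have [e ie] : exists e, is_edge a (q a) e by apply: is_edge_exists; rewrite eq_sym.
apply/connect1/(adj_edge ie); rewrite /two_factor (matchedE S' ie) sa /switch.
by rewrite !inE !eqxx addn1.
Qed.

(** Each switch strictly enlarges the set of connected pairs, so the process ends. *)
Lemma hamiltonian_matching p q : (forall e, x e = 0 \/ x e = 1 / 2 \/ x e = 1) ->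
  square_matchings x sq p q -> in_SUBT x ->
  exists p' q', square_matchings x sq p' q' /\
    (forall i j, connect (adj (two_factor x sq p')) i j).
Proof.
move=> half S sub.
pose C p := [set ij : 'I_n * 'I_n | connect (adj (two_factor x sq p)) ij.1 ij.2].
move: {2}(#|{: 'I_n * 'I_n}| - #|C p|)%N (leqnn (#|{: 'I_n * 'I_n}| - #|C p|)) => N.
elim: N p q S => [|N IHN] p q S CN.
  exists p, q; split=> // i j.
  have : C p = setT.
    by apply/eqP; rewrite eqEcard subsetT cardsT -subn_eq0 -leqn0.
  by move/setP/(_ (i, j)); rewrite !inE.
case: (pickP (fun ij => ij \notin C p)) => [[i j]|full]; last first.
  by exists p, q; split=> // i j; have := full (i, j); rewrite inE /= => /negbFE.
rewrite inE /= => nij; pose X := [set v | connect (adj (two_factor x sq p)) i v].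
(* A subtour constraint gives a support edge leaving the component [X]. Being neither a 1-edge nor a
   [p]-edge, it is a [q]-edge, and its square is the one to switch. *)
have [e /andP[ce xe]] : exists e, in_cut X e && (x e != 0).
  case: (pickP (fun e => in_cut X e && (x e != 0))) => [e|none]; first by exists e.
  have [_ [_ /(_ X)]] := sub; rewrite /cut_sum big1 => [|e ce]; last first.
    by have := none e; rewrite ce => /negbFE/eqP.
  have X0 : X != set0 by apply/set0Pn; exists i; rewrite inE connect0.
  have XT : X != setT by apply/eqP=> /setP/(_ j); rewrite !inE (negbTE nij).
  by move=> /(_ X0 XT); rewrite (ler_nat _ 2 0).
have ie0 := is_edge_self e.
have [u [v [ie uX vX]]] : exists u v, [/\ is_edge u v e, u \in X & v \notin X].
  move: ce; rewrite (in_cut_edge _ ie0).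
  case: (boolP ((val e).1 \in X)) => h1; case: (boolP ((val e).2 \in X)) => h2 // _.
    by exists (val e).1, (val e).2.
  by exists (val e).2, (val e).1; rewrite is_edgeC.
have nuv : ~~ connect (adj (two_factor x sq p)) u v.
  by apply: contra vX; rewrite !inE => h; apply: connect_trans h; rewrite inE in uX.
have te0 : two_factor x sq p e = 0%N.
  by apply/eqP; rewrite -leqn0 leqNgt; apply: contra nuv => te; apply/connect1/(adj_edge ie).
have [su vq] : sq u /\ v = q u.
  move: te0 xe; rewrite /two_factor (half_value (half e)) (in_H_matched e S).
  have S2 := square_matchingsC S; rewrite (matchedE S2 ie).
  case: (in_W x e) => //; case: (matched sq p e) => //= _.
  case: (boolP (sq u)) => /= su; last by rewrite mul0r addr0 eqxx.
  by have [//|_] := eqVneq v (q u); rewrite mul0r addr0 eqxx.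
rewrite vq in nuv.
have [s1 s2] := switch_connect half S sub su nuv.
apply: (IHN _ _ (switch_matchings S su)).
have pr : (#|C p| < #|C (switch p q u)|)%N.
  apply: proper_card; apply/properP; split.
    by apply/subsetP=> ij; rewrite !inE; apply: s1.
  by exists (u, q u); rewrite inE.
rewrite -ltnS (leq_trans _ CN) // ltn_sub2l //.
exact: leq_trans pr (max_card _).
Qed.

End Hamiltonian.

(** * The two matchings of each 4-cycle *)

Section Cycles.
Variable n : nat.
Implicit Types (c : 'I_n * 'I_n * 'I_n * 'I_n) (v i j : 'I_n).

(** The matching ab, cd of the cycle abcd; [other_mate] is the matching ad, bc. *)
Definition side_mate c v :=
  let: (a, b, c', d) := c in
  if v == a then b else if v == b then a else if v == c' then d else c'.

Definition other_mate c v :=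
  let: (a, b, c', d) := c in
  if v == a then d else if v == d then a else if v == b then c' else b.

Lemma is_edge_eq i j a b (e : edge n) : is_edge i j e ->
  is_edge a b e = (i == a) && (j == b) || (i == b) && (j == a).
Proof.
by rewrite /is_edge => /orP[]/andP[/eqP-> /eqP->] //; rewrite orbC ![(j == _) && _]andbC.
Qed.

Lemma four_distinct_mates c v : four_distinct c -> v \in cyc_verts c ->
  let p := side_mate c in let q := other_mate c in
  [/\ p v \in cyc_verts c, p (p v) = v, p v != v & p v != q v] /\
  [/\ q v \in cyc_verts c, q (q v) = v, q v != v & q (p v) = p (q v)].
Proof.
case: c => [[[a b] c] d]; rewrite /= !inE !negb_or.
move=> /and4P[/and3P[ab ac ad] /andP[bc bd] cd _].
have [ba [ca da]] : b != a /\ c != a /\ d != a by rewrite ![_ == a]eq_sym.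
have [cb [db dc]] : c != b /\ d != b /\ d != c by rewrite ![_ == b]eq_sym [d == c]eq_sym.
by case/or4P=> /eqP->; repeat rewrite ?eqxx ?(negbTE ab) ?(negbTE ac) ?(negbTE ad) ?(negbTE bc)
  ?(negbTE bd) ?(negbTE cd) ?(negbTE ba) ?(negbTE ca) ?(negbTE da) ?(negbTE cb)
  ?(negbTE db) ?(negbTE dc) ?orbT /=.
Qed.

Lemma cyc_edge_mates c i j (e : edge n) : four_distinct c -> is_edge i j e ->
  cyc_edge c e = (i \in cyc_verts c) && ((j == side_mate c i) || (j == other_mate c i)).
Proof.
case: c => [[[a b] c] d] + ie; rewrite /= !inE !negb_or !(is_edge_eq _ _ ie).
move=> /and4P[/and3P[ab ac ad] /andP[bc bd] cd _].
have [ba [ca da]] : b != a /\ c != a /\ d != a by rewrite ![_ == a]eq_sym.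
have [cb [db dc]] : c != b /\ d != b /\ d != c by rewrite ![_ == b]eq_sym [d == c]eq_sym.
have [->|ia] := eqVneq i a.
  by rewrite (negbTE ab) (negbTE ac) (negbTE ad) /= ?orbF.
have [->|ib] := eqVneq i b.
  by rewrite (negbTE bc) (negbTE bd) /= ?orbF.
have [->|ic] := eqVneq i c.
  by rewrite (negbTE cd) /= ?orbF orbC.
by have [_|_] := eqVneq i d; rewrite /= ?orbF ?andbF // orbC.
Qed.

Variables (R : numFieldType) (x : edge n -> R).

(** Disjointness makes the cycle through a vertex unique, so the matchings of the single cycles
    combine into global maps. In [cyc] the default is a dummy for vertices on no cycle. *)
Lemma square_matchings_exist : H_union_of_4cycles x ->
  exists sq p q, square_matchings x sq p q.
Proof.
move=> [cs [dist [disj Hcs]]].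
pose has_v v c := v \in cyc_verts c.
pose cyc v := nth (v, v, v, v) cs (find (has_v v) cs).
pose sq v := has (has_v v) cs.
have uniqc c1 c2 v : c1 \in cs -> c2 \in cs -> v \in cyc_verts c1 -> v \in cyc_verts c2 -> c1 = c2.
  move=> h1 h2 v1 v2.
  have i1 := nth_index c1 h1; have i2 := nth_index c2 h2.
  have s1 : (index c1 cs < size cs)%N by rewrite index_mem.
  have s2 : (index c2 cs < size cs)%N by rewrite index_mem.
  have [lt|gt|E] := ltngtP (index c1 cs) (index c2 cs).
  - have := disj _ _ (introT andP (conj lt s2)) c1 c2 (esym i1) (esym i2).
    by move/disjointFr/(_ v1); rewrite v2.
  - have := disj _ _ (introT andP (conj gt s1)) c2 c1 (esym i2) (esym i1).
    by move/disjointFr/(_ v2); rewrite v1.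
  - by rewrite -i1 -i2 E; apply: set_nth_default; rewrite -E.
have cycE c v : c \in cs -> v \in cyc_verts c -> cyc v = c.
  move=> cc vc; have hv : has (has_v v) cs by apply/hasP; exists c.
  by apply: (@uniqc _ _ v) => //; [rewrite mem_nth -?has_find | exact: (nth_find (v, v, v, v) hv)].
pose p v := side_mate (cyc v) v; pose q v := other_mate (cyc v) v.
exists sq, p, q.
have sqP v : sq v -> exists2 c, c \in cs & [/\ v \in cyc_verts c, four_distinct c
    & forall u, u \in cyc_verts c -> [/\ sq u, p u = side_mate c u & q u = other_mate c u]].
  case/hasP=> c cc vc; exists c => //; split=> //; first exact: dist.
  by move=> u uc; rewrite /p /q (cycE _ _ cc uc); split=> //; apply/hasP; exists c.
split; last split.
- move=> v /sqP[c cc [vc dc pq]].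
  have [[a1 a2 a3 a4] [b1 b2 b3 b4]] := four_distinct_mates dc vc.
  have [_ -> ->] := pq v vc.
  by have [-> -> _] := pq _ a1.
- move=> v /sqP[c cc [vc dc pq]].
  have [[a1 a2 a3 a4] [b1 b2 b3 b4]] := four_distinct_mates dc vc.
  have [_ -> ->] := pq v vc.
  by have [_ _ ->] := pq _ a1; have [-> -> ->] := pq _ b1.
- move=> i j e ie; rewrite Hcs; apply/hasP/andP.
    move=> [c cc]; rewrite (cyc_edge_mates (dist _ cc) ie) => /andP[ic].
    by rewrite /p /q (cycE _ _ cc ic); split=> //; apply/hasP; exists c.
  move=> [/sqP[c cc [ic dc /(_ _ ic)[_ -> ->]]] jpq]; exists c => //.
  by rewrite (cyc_edge_mates dc ie) ic.
Qed.

End Cycles.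

(** * The contracted graph Q *)

Lemma even_card_involution (T : finType) (tau : T -> T) (A : {set T}) :
  {in A, forall y, [/\ tau y \in A, tau (tau y) = y & tau y != y]} ->
  ~~ odd #|A|.
Proof.
move: {2}#|A| (leqnn #|A|) => m; elim: m A => [|m IHm] A Am tauA.
  by move: Am; rewrite leqn0 => /eqP->.
have [->|/set0Pn[y yA]] := eqVneq A set0; first by rewrite cards0.
have [tyA tty ty] := tauA y yA.
have yB : tau y \in A :\ y by rewrite !inE ty.
have cA : #|A| = #|A :\ y :\ tau y|.+2.
  by rewrite (cardsD1 y) yA (cardsD1 (tau y) (A :\ y)) yB.
rewrite cA /= negbK; apply: IHm => [|z]; first by lia.
rewrite !inE => /and3P[zt zy zA]; have [tzA ttz tz] := tauA z zA.
split=> //; rewrite tzA andbT; apply/andP; split.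
  by apply: contraNneq zy => E; rewrite -ttz E tty.
by apply: contraNneq zt => E; rewrite -E ttz.
Qed.

Section QGraph.
Variables (R : realFieldType) (n : nat) (x : edge n -> R) (sq : pred 'I_n).
Variables (p q : 'I_n -> 'I_n).
Variable S : square_matchings x sq p q.

(* Q has one node for each pair {v, q v} of square vertices, represented by its
   smaller element and the bit false.  A vertex v outside the squares, which has
   two 1-edges, is split into (v, false) and (v, true), one for each of them; the
   gadget edge joining the two copies forces a perfect matching to contain both
   1-edges at v or none. *)
Definition raw_node (v : 'I_n) (b : bool) : 'I_n * bool :=
  if sq v then (if (v <= q v)%N then v else q v, false) else (v, b).

Notation qnode := {y : 'I_n * bool | raw_node y.1 y.2 == y}.

Lemma raw_node_idem v b : raw_node (raw_node v b).1 (raw_node v b).2 == raw_node v b.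
Proof.
rewrite {2 3 4}/raw_node; case: (boolP (sq v)) => sv /=; last by rewrite /raw_node (negbTE sv).
have [sqv qqv qv _] := S.2.1 v sv.
case: ifP => vq; first by rewrite /raw_node sv vq.
have qv' : (q v <= v)%N by rewrite ltnW // ltnNge vq.
by rewrite /raw_node sqv qqv qv'.
Qed.

Definition node (v : 'I_n) (b : bool) : qnode :=
  exist _ (raw_node v b) (raw_node_idem v b).

Lemma node_eq v b v' b' : (node v b == node v' b') =
  if sq v then (v' == v) || (v' == q v) else (v == v') && (b == b').
Proof.
rewrite -val_eqE /= /raw_node; case: (boolP (sq v)) => sv.
  have [sqv qqv qv _] := S.2.1 v sv.
  case: (boolP (sq v')) => sv'; last first.
    have -> : (v' == v) = false by apply: contraNF sv' => /eqP->.
    have -> : (v' == q v) = false by apply: contraNF sv' => /eqP->.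
    case: ifP => _; rewrite xpair_eqE eq_sym; last first.
      by rewrite (_ : (v' == q v) = false) //; apply: contraNF sv' => /eqP->.
    by rewrite (_ : (v' == v) = false) //; apply: contraNF sv' => /eqP->.
  have [sqv' qqv' qv' _] := S.2.1 v' sv'.
  have [->|n1] := eqVneq v' v; first by rewrite eqxx.
  have [->|n2] := eqVneq v' (q v).
    rewrite qqv; case: ltngtP => // h; rewrite ?eqxx //.
    by have /val_inj := h => E; rewrite -E eqxx in qv.
  apply/negbTE; rewrite xpair_eqE andbT /=.
  case: ifP => _; case: ifP => _.
  - by rewrite eq_sym.
  - by apply: contraNneq n2 => ->; rewrite qqv'.
  - by rewrite eq_sym.
  - by apply: contraNneq n1 => E; rewrite -[v']qqv' -E qqv.
case: (boolP (sq v')) => sv'.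
  have [sqv' qqv' qv' _] := S.2.1 v' sv'.
  have n1 : (v == v') = false by apply: contraNF sv => /eqP->.
  have n2 : (v == q v') = false by apply: contraNF sv => /eqP->.
  by rewrite n1 /=; case: ifP => _; rewrite xpair_eqE ?n1 ?n2.
by rewrite xpair_eqE.
Qed.

Lemma nodeP (y : qnode) : exists v b, y = node v b.
Proof. by exists (val y).1, (val y).2; apply/val_inj/esym/eqP/(valP y). Qed.

Lemma node_q v b : sq v -> node (q v) b = node v b.
Proof. by move=> sv; apply/esym/eqP; rewrite node_eq sv eqxx orbT. Qed.

Lemma node_sq v b b' : sq v -> node v b = node v b'.
Proof. by move=> sv; apply/eqP; rewrite node_eq sv eqxx. Qed.

(** An arbitrary 1-edge at [v]. At a split vertex it is attached to the copy [true], the other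
    1-edge to the copy [false]. *)
Definition first_W (v : 'I_n) : option (edge n) :=
  [pick e | in_W x e && incident v e].

Definition dart (v : 'I_n) (e : edge n) : qnode := node v (Some e == first_W v).

Notation qedge := (edge n + 'I_n)%type.

(* inl e is the 1-edge e.  For i in a square, inr i is one of four parallel
   copies of the edge of that square, so that each copy gets weight 1/8; for
   other i, inr i is the gadget edge of i. *)
Definition qsource (k : qedge) : qnode :=
  match k with inl e => dart (val e).1 e | inr i => node i false end.
Definition qtarget (k : qedge) : qnode :=
  match k with
  | inl e => dart (val e).2 e
  | inr i => if sq i then node (p i) false else node i true
  end.
(** A contracted pair sees two 1-edges and four square copies, 2/4 + 4/8 = 1; a copy of a split
    vertex sees one 1-edge and the gadget edge, 1/4 + 3/4 = 1. *)
Definition qweight (k : qedge) : R :=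
  match k with
  | inl e => if in_W x e then 1 / 4 else 0
  | inr i => if sq i then 1 / 8 else 3 / 4
  end.

Lemma W_not_q v e : in_W x e -> sq v -> is_edge v (q v) e = false.
Proof.
move=> We sv; apply/negP=> ie; have := in_WH We.
by rewrite (S.2.2 _ _ _ ie) sv eqxx orbT.
Qed.

Lemma cut_W_sq v b e : in_W x e -> sq v ->
  (inl e \in cut_edges qsource qtarget [set node v b]) = incident v e || incident (q v) e.
Proof.
move=> We sv; have nq := W_not_q We sv; have ne := edge_neq e.
rewrite !inE /= /dart ![_ == node v b]eq_sym !node_eq sv /incident.
rewrite ![v == _]eq_sym ![q v == _]eq_sym.
have h1 : ~~ (((val e).1 == v) && ((val e).2 == v)).
  by apply: contra ne => /andP[/eqP-> /eqP->].
have h2 : ~~ (((val e).1 == q v) && ((val e).2 == q v)).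
  by apply: contra ne => /andP[/eqP-> /eqP->].
move: nq h1 h2; rewrite /is_edge /=.
by case: (_ == v); case: (_ == q v); case: (_ == v); case: (_ == q v).
Qed.

Lemma incident_q v e : in_W x e -> sq v -> incident v e -> ~~ incident (q v) e.
Proof.
move=> We sv iv; have [_ _ qv _] := S.2.1 v sv.
apply/negP=> iqv; have := W_not_q We sv; rewrite /is_edge.
move: iv iqv qv => /orP[]/eqP-> /orP[]/eqP->; rewrite ?eqxx ?orbT //.
Qed.

Lemma cut_inr_sq v b i : sq v ->
  (inr i \in cut_edges qsource qtarget [set node v b]) = (i \in square p q v).
Proof.
move=> sv; rewrite !inE /= ![_ == node v b]eq_sym.
have [sqv _ _ _] := S.2.1 v sv; have [_ ppv _ _] := S.1 v sv; have [_ ppqv _ _] := S.1 _ sqv.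
case: (boolP (sq i)) => si; rewrite !node_eq sv; last first.
  rewrite eqxx; apply/esym; apply: contraNF si.
  by rewrite -!orbA -/(pred4 _ _ _ _ i) => /or4P[]/eqP->; rewrite ?sv ?sqv //; have [] := S.1 _ sv; have [] := S.1 _ sqv.
have [spi ppi _ _] := S.1 i si.
have e1 : (p i == v) = (i == p v) by apply/eqP/eqP=> [<-|->].
have e2 : (p i == q v) = (i == p (q v)) by apply/eqP/eqP=> [<-|->].
rewrite e1 e2; have := square_card S sv; rewrite /= !inE !negb_or.
move=> /and4P[/and3P[/negbTE n1 /negbTE n2 /negbTE n3] /andP[/negbTE n4 /negbTE n5] /negbTE n6 _].
have [->|_] := eqVneq i v; first by rewrite n1 n3.
have [->|_] := eqVneq i (q v); first by rewrite (eq_sym (q v) (p v)) n4 n6.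
by case: (i == p v); case: (i == p (q v)).
Qed.

Lemma cut_W_nsq v b e : ~~ sq v ->
  (inl e \in cut_edges qsource qtarget [set node v b]) =
  incident v e && ((Some e == first_W v) == b).
Proof.
move=> sv; have ne := edge_neq e.
rewrite !inE /= /dart ![_ == node v b]eq_sym !node_eq (negbTE sv) /incident.
rewrite ![b == _]eq_sym; move: ne.
have [<-|_] := eqVneq v (val e).1; have [<-|_] := eqVneq v (val e).2 => //= _;
by case: (_ == b).
Qed.

Lemma cut_inr_nsq v b i : ~~ sq v ->
  (inr i \in cut_edges qsource qtarget [set node v b]) = (i == v).
Proof.
move=> sv; rewrite !inE /= ![_ == node v b]eq_sym.
case: (boolP (sq i)) => si; rewrite !node_eq (negbTE sv).
  have [spi _ _ _] := S.1 i si.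
  have n1 : (v == i) = false by apply: contraNF sv => /eqP->.
  have n2 : (v == p i) = false by apply: contraNF sv => /eqP->.
  by rewrite [i == v]eq_sym n1 n2.
by rewrite [i == v]eq_sym; case: (v == i) => //; case: b.
Qed.

Section Sums.
Variables (M : nmodType) (F : qedge -> M).

(** The general codomain serves both the weights in [R] and the number of edges of a perfect
    matching at a node. *)
Lemma sum_cut_sq v b : sq v -> (forall e, ~~ in_W x e -> F (inl e) = 0) ->
  \sum_(k in cut_edges qsource qtarget [set node v b]) F k =
  \sum_(e | incident v e) F (inl e) + \sum_(e | incident (q v) e) F (inl e)
  + \sum_(i in square p q v) F (inr i).
Proof.
move=> sv F0; rewrite big_mkcond big_sumType /=; congr (_ + _); last first.
  by rewrite [RHS]big_mkcond; apply: eq_bigr => i _; rewrite cut_inr_sq.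
rewrite [X in _ = X + _]big_mkcond [X in _ = _ + X]big_mkcond -big_split /=.
apply: eq_bigr => e _; case: (boolP (in_W x e)) => We; last first.
  by rewrite F0 //; do 3!case: ifP => _; rewrite ?addr0.
rewrite cut_W_sq //; have := incident_q We sv.
by case: (incident v e) => /= [/(_ isT)/negbTE->|_]; rewrite ?addr0 // add0r.
Qed.

Lemma sum_cut_nsq v b : ~~ sq v ->
  \sum_(k in cut_edges qsource qtarget [set node v b]) F k =
  \sum_(e | incident v e && ((Some e == first_W v) == b)) F (inl e) + F (inr v).
Proof.
move=> sv; rewrite big_mkcond big_sumType /=; congr (_ + _).
  by rewrite [RHS]big_mkcond; apply: eq_bigr => e _; rewrite cut_W_nsq.
rewrite (bigD1 v) //= cut_inr_nsq // eqxx big1 ?addr0 // => i /negbTE iv.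
by rewrite cut_inr_nsq // iv.
Qed.

End Sums.

Lemma qweight_loop k : qsource k = qtarget k -> qweight k = 0.
Proof.
case: k => [e|i] /= /eqP.
  case: ifP => // We; rewrite /dart node_eq; have ne := edge_neq e.
  rewrite eq_sym (negbTE ne) /=.
  case: ifP => // sv /eqP E; have := W_not_q We sv.
  by rewrite -E is_edge_self.
case: (boolP (sq i)) => si; rewrite node_eq ?si ?(negbTE si) ?andbF //.
by have [_ _ /negbTE-> /negbTE->] := S.1 i si.
Qed.

Hypothesis half : forall e, x e = 0 \/ x e = 1 / 2 \/ x e = 1.
Hypothesis sub : in_SUBT x.

Lemma sum_qweight_W (A : pred (edge n)) :
  \sum_(e | A e) qweight (inl e) = (\sum_(e | A e) (in_W x e : nat))%:R / 4.
Proof.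
rewrite natr_sum mulr_suml; apply: eq_bigr => e _ /=.
by case: ifP; rewrite ?mul0r.
Qed.

Lemma degree_Wn v : (\sum_(e | incident v e) (in_W x e : nat) = if sq v then 1 else 2)%N.
Proof. exact: degree_W half S sub. Qed.

Lemma degree_W_first v : ~~ sq v ->
  (forall b, \sum_(e | incident v e && ((Some e == first_W v) == b)) (in_W x e : nat) = 1)%N.
Proof.
move=> sv; have := degree_Wn v; rewrite (negbTE sv) (bigID (fun e => Some e == first_W v)) /=.
rewrite /first_W; case: pickP => [e0 /andP[We0 ie0]|none]; last first.
  rewrite addnC big1 => [|e /andP[ie _]]; last by have := none e; rewrite ie andbT => ->.
  by rewrite big1 // => e /andP[ie _]; have := none e; rewrite ie andbT => ->.
rewrite (big_pred1 e0) ?We0 => [|e]; last first.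
  by rewrite /= (inj_eq Some_inj); case: eqP => [->|]; rewrite ?ie0 ?andbF.
move=> /= [] d1; case.
  rewrite (big_pred1 e0) ?We0 // => e.
  by rewrite /= eqb_id (inj_eq Some_inj); case: eqP => [->|]; rewrite ?ie0 ?andbF.
by rewrite -[RHS]d1; apply: eq_bigl => e; rewrite eqbF_neg.
Qed.

Lemma qweight_degree y : \sum_(k in cut_edges qsource qtarget [set y]) qweight k = 1.
Proof.
have [v [b ->]] := nodeP y; case: (boolP (sq v)) => sv.
  have [sqv _ _ _] := S.2.1 v sv.
  rewrite sum_cut_sq // => [|e /negbTE /= -> //].
  rewrite !sum_qweight_W !degree_Wn sv sqv (eq_bigr (fun=> 1 / 8)); last first.
    by move=> i /(square_sq S sv) /= ->.
  by rewrite sumr_const (card_square S sv); field.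
rewrite sum_cut_nsq // sum_qweight_W degree_W_first //= (negbTE sv).
by field.
Qed.

End QGraph.

(** * The odd cut constraints of Q *)

Section CutBound.
Variables (R : realFieldType) (n : nat) (x : edge n -> R) (sq : pred 'I_n).
Variables (p q : 'I_n -> 'I_n).
Variable S : square_matchings x sq p q.
Variable half : forall e, x e = 0 \/ x e = 1 / 2 \/ x e = 1.
Variable sub : in_SUBT x.

Lemma sum_matched v (G : edge n -> nat) g :
  (forall e, is_edge v (p v) e -> G e = g) ->
  (\sum_(e | incident v e) matched sq p e * G e = sq v * g)%N.
Proof.
move=> Gg; have := degree_matched v S; rewrite /degree => <-.
rewrite big_distrl /=; apply: eq_bigr => e /incidentP[u ie].
by rewrite (matchedE S ie); case: eqP => [up|]; rewrite ?andbF // (Gg e) // -up.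
Qed.

Local Notation qnode := {y : 'I_n * bool | raw_node sq q y.1 y.2 == y}.
Variable U : {set qnode}.
Local Notation node := (node S).
Local Notation cutQ := (cut_edges (qsource S) (qtarget S)).

(* A cut of Q is compared with the cut of K_n defined by its trace. *)
Definition trace : {set 'I_n} := [set v | node v true \in U].
Definition split_nodes : {set 'I_n} :=
  [set v | ~~ sq v && ((node v true \in U) != (node v false \in U))].
(** These are the indices of the square copies [inr i] crossing the cut, four for each square that
    is split. *)
Definition split_squares : {set 'I_n} :=
  [set i | sq i && ((i \in trace) != (p i \in trace))].
Definition cut_W : nat := (\sum_(e | inl e \in cutQ U) in_W x e)%N.

Lemma node_trace v b : v \notin split_nodes -> (node v b \in U) = (v \in trace).
Proof.
rewrite !inE; case: (boolP (sq v)) => sv; first by rewrite (node_sq S b true sv).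
by case: b => //= /negPn/eqP->.
Qed.

Lemma trace_q v : sq v -> (q v \in trace) = (v \in trace).
Proof. by move=> sv; rewrite !inE node_q. Qed.

Lemma qweight_cut : \sum_(k in cutQ U) qweight x sq k =
  cut_W%:R / 4 + #|split_squares|%:R / 8 + 3 / 4 * #|split_nodes|%:R.
Proof.
rewrite big_mkcond big_sumType /= -addrA; congr (_ + _).
  by rewrite -big_mkcond sum_qweight_W.
rewrite -!sum1_card !natr_sum mulr_suml mulr_sumr.
rewrite [X in _ = X + _]big_mkcond [X in _ = _ + X]big_mkcond -big_split /=.
apply: eq_bigr => i _; rewrite !inE /=.
case: (boolP (sq i)) => si /=.
  have [spi _ _ _] := S.1 i si.
  rewrite (node_sq S false true si) (node_sq S false true spi).
  by case: ifP => _; rewrite ?mul1r ?addr0.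
by rewrite eq_sym; case: ifP => _; rewrite ?mulr1 ?add0r.
Qed.

Lemma card_split_squares :
  (#|split_squares| = 2 * \sum_(e | in_cut trace e) matched sq p e)%N.
Proof.
have := sum_degree (fun e => matched sq p e * in_cut trace e)%N setT.
rewrite (eq_bigr (fun v => (v \in split_squares) : nat)) => [|v _]; last first.
  rewrite /degree (@sum_matched _ _ ((v \in trace) != (p v \in trace))) => [|e ie].
    by rewrite [in RHS]inE; case: (sq v); rewrite ?mul1n.
  by rewrite (in_cut_edge _ ie).
rewrite (eq_bigl predT) => [|v]; last by rewrite inE.
rewrite -big_mkcond /= sum1_card => ->.
rewrite [in RHS]big_mkcond big_distrr /=; apply: eq_bigr => e _.
by rewrite !inE; case: ifP; rewrite ?muln0 // muln1 mulnC.
Qed.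

(** Contracted [q]-edges never cross the trace. A crossing [p]-edge has value 1/2 and both ends in
    [split_squares], hence 1/4 per element. *)
Lemma cut_sum_trace : cut_sum x trace =
  (\sum_(e | in_cut trace e) (in_W x e : nat))%:R + #|split_squares|%:R / 4.
Proof.
rewrite card_split_squares natrM natr_sum.
rewrite /cut_sum (eq_bigr (fun e => (in_W x e)%:R + (matched sq p e)%:R / 2)).
  by rewrite big_split /= natr_sum -mulr_suml; congr (_ + _); field.
move=> e; have ie := is_edge_self e; rewrite (in_cut_edge _ ie) => ce.
rewrite (half_value (half e)) (in_H_matched e S).
suff -> : matched sq q e = false by rewrite orbF.
apply: contraNF ce => /andP[s /eqP ->]; apply/eqP/esym.
by rewrite trace_q.
Qed.

Lemma split_squares_ge4 i : i \in split_squares -> (4 <= #|split_squares|)%N.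
Proof.
rewrite inE => /andP[si ci].
have := square_card S si => /card_uniqP/= <-; apply: subset_leq_card.
have [spi ppi _ _] := S.1 i si; have [sqi qqi _ qpi] := S.2.1 i si.
have [spqi ppqi _ _] := S.1 _ sqi.
have tpq : (p (q i) \in trace) = (p i \in trace) by rewrite -qpi trace_q.
apply/subsetP=> v; rewrite !in_cons in_nil orbF => /or4P[]/eqP->; rewrite in_set.
- by rewrite si.
- by rewrite spi ppi eq_sym.
- by rewrite sqi trace_q // tpq.
- by rewrite spqi ppqi tpq trace_q // eq_sym.
Qed.

(** By the handshake count: only square vertices have odd degree in W, and [q] pairs those in the
    trace. *)
Lemma even_trace_W : ~~ odd (\sum_(e | in_cut trace e) (in_W x e : nat)).
Proof.
rewrite -(handshake (fun e => in_W x e : nat) trace).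
have -> : odd (\sum_(v in trace) degree (fun e => in_W x e : nat) v)
  = odd (\sum_(v in trace) sq v).
  elim/big_rec2: _ => // v m k _ h; rewrite !oddD h (degree_W v half S sub).
  by case: (sq v).
rewrite -big_mkcondr /= (eq_bigl [in [set v in trace | sq v]]) => [|v]; last first.
  by rewrite [in RHS]inE.
rewrite sum1_card.
apply: (@even_card_involution _ q) => v /setIdP[vt sv].
have [sqv qqv qv _] := S.2.1 v sv.
by rewrite inE trace_q // vt sqv.
Qed.

(** If neither gadget nor square edges cross, exchanging the ends of these edges is a
    fixed-point-free involution of [U], so |U| is even. *)
Lemma split_squares_neq0 : split_nodes = set0 -> odd #|U| -> split_squares != set0.
Proof.
move=> D0; apply: contraTneq => S0.
pose tau (y : qnode) :=
  if sq (val y).1 then node (p (val y).1) true else node (val y).1 (~~ (val y).2).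
have tauE v b : tau (node v b) = if sq v then node (p v) true else node v (~~ b).
  rewrite /tau /= /raw_node; case: (boolP (sq v)) => sv /=; last by rewrite (negbTE sv).
  have [spv _ _ _] := S.1 v sv; have [sqv _ _ qpv] := S.2.1 v sv.
  by case: (v <= q v)%N; rewrite /= ?sv ?sqv // -qpv node_q.
have inU u c : (node u c \in U) = (u \in trace) by apply: node_trace; rewrite D0 inE.
apply: (@even_card_involution _ tau) => y.
have [v [b ->]] := nodeP S y; rewrite inU => vt; rewrite !tauE.
case: (boolP (sq v)) => sv; last first.
  rewrite tauE (negbTE sv) negbK inU; split=> //.
  by rewrite node_eq (negbTE sv) eqxx; case: (b).
have [spv ppv pv pqv] := S.1 v sv.
rewrite tauE spv ppv inU; split=> //.
- have : v \notin split_squares by rewrite S0 inE.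
  by rewrite inE sv vt /= negbK => /eqP <-.
- exact: node_sq.
- have [_ qqpv _ _] := S.2.1 _ spv.
  rewrite node_eq spv eq_sym (negbTE pv) /=.
  by apply: contra pqv => /eqP E; apply/eqP; rewrite {2}E qqpv.
Qed.

Lemma trace_proper v u : (v \in trace) != (u \in trace) ->
  (trace != set0) && (trace != setT).
Proof.
move=> vu; apply/andP; split; apply: contraNneq vu => ->; by rewrite !inE.
Qed.

Lemma trace_cut_ge2 v u : (v \in trace) != (u \in trace) ->
  (8 <= 4 * \sum_(e | in_cut trace e) (in_W x e : nat) + #|split_squares|)%N.
Proof.
move=> /trace_proper/andP[t0 tT]; have [_ [_ /(_ _ t0 tT)]] := sub.
rewrite cut_sum_trace; set a := (\sum_(e | _) _)%N; set b := #|_| => ab.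
by rewrite -(ler_nat R) natrD natrM; lra.
Qed.

(** Scaled by 8, a 1-edge counts 2, a square copy 1, a gadget edge 6. At least four copies cross and
    the number of 1-edges is even: two 1-edges suffice, and with none the subtour bound forces eight
    copies. *)
Lemma qcut_ge1_nosplit : split_nodes = set0 -> odd #|U| ->
  (8 <= 2 * cut_W + #|split_squares|)%N.
Proof.
move=> D0 oU; have /set0Pn[i iS] := split_squares_neq0 D0 oU.
have s4 := split_squares_ge4 iS.
have ci : (i \in trace) != (p i \in trace) by move: iS; rewrite inE => /andP[].
have := trace_cut_ge2 ci; have := even_trace_W.
have -> : (\sum_(e | in_cut trace e) (in_W x e : nat) = cut_W)%N.
  by apply: eq_bigl => e; rewrite [in RHS]inE /= /dart !node_trace ?D0 ?in_set0.
by move: s4; lia.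
Qed.

(* If the gadget edge of i were the only edge in the cut, then its trace would
   cut a single 1-edge of K_n, against the subtour constraint. *)
Lemma qcut_ge1_split i : split_nodes = [set i] ->
  (8 <= 2 * cut_W + #|split_squares| + 6)%N.
Proof.
move=> Di; rewrite leqNgt; apply/negP=> small.
have iD : i \in split_nodes by rewrite Di set11.
have [si ci] : ~~ sq i /\ (node i true \in U) != (node i false \in U).
  by move: iD; rewrite inE => /andP.
have S0 : #|split_squares| = 0%N.
  apply/eqP; rewrite cards_eq0; apply: contraTT small => /set0Pn[k /split_squares_ge4].
  by rewrite -leqNgt; lia.
have W0 : cut_W = 0%N by move: small; lia.
have nc e : in_W x e -> inl e \notin cutQ U.
  move=> We; apply/negP=> ce; move: W0; rewrite /cut_W (bigD1 e) //= We.
  by rewrite add1n.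
have nD u : u != i -> u \notin split_nodes by move=> ui; rewrite Di inE.
have d2 := degree_W_first S half sub si false.
have [e0 [We0 ie0 fe0]] : exists e0, [/\ in_W x e0, incident i e0 & (Some e0 == first_W x i) = false].
  case: (pickP (fun e => [&& in_W x e, incident i e & (Some e == first_W x i) == false])) => [e /and3P[? ? /eqP ?]|none].
    by exists e.
  by move: d2; rewrite big1 // => e /andP[ie fe]; have := none e; rewrite ie fe !andbT => ->.
have [u iu] := incidentP ie0.
have ui : u != i by rewrite eq_sym; apply: is_edge_neq iu.
have cutE0 : (dart S i e0 \in U) = (dart S u e0 \in U).
  have := nc _ We0; rewrite inE /= negbK.
  by case/orP: iu => /andP[/eqP-> /eqP->] /eqP.
have iu_cut : (i \in trace) != (u \in trace).
  rewrite -(node_trace (Some e0 == first_W x u) (nD u ui)) -/(dart S u e0) -cutE0.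
  by rewrite /dart fe0 inE.
(* The trace records the copy [true], so with no 1-edge in the cut of Q only the 1-edge at the other
   copy of [i] can cross the trace. *)
have le1 : (\sum_(e | in_cut trace e) (in_W x e : nat) <= 1)%N.
  rewrite -[X in (_ <= X)%N]d2 big_mkcond [X in (_ <= X)%N]big_mkcond /=.
  apply: leq_sum => e _; case: (boolP (in_W x e)) => We; last by do 2!case: ifP.
  have := nc _ We; rewrite inE /= negbK /dart => /eqP dd.
  case: ifP => // ce; case: ifP => // /negbT; rewrite /incident.
  have ie := is_edge_self e; rewrite (in_cut_edge _ ie) in ce.
  move: ce dd; have [E1|n1] := eqVneq i (val e).1; have [E2|n2] := eqVneq i (val e).2 => /=.
  - by have := edge_neq e; rewrite -E1 -E2 eqxx.
  - rewrite -E1 (node_trace _ (nD (val e).2 _)) 1?eq_sym // => ce dd.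
    case: eqP => // fe; case: (Some e == _) fe dd => // _ dd.
    by rewrite -dd inE eqxx in ce.
  - rewrite -E2 (node_trace _ (nD (val e).1 _)) 1?eq_sym // => ce dd.
    case: eqP => // fe; case: (Some e == _) fe dd => // _ dd.
    by rewrite dd inE eqxx in ce.
  - rewrite (node_trace _ (nD (val e).1 _)) 1?eq_sym //.
    rewrite (node_trace _ (nD (val e).2 _)) 1?eq_sym // => ce dd.
    by rewrite dd eqxx in ce.
have := trace_cut_ge2 iu_cut; rewrite S0 addn0; move: le1.
by case: (\sum_(e | _) _)%N => [|[|m]].
Qed.

(** By the number of gadget edges in the cut; two of them already weigh 3/2. *)
Lemma qweight_odd_cut : odd #|U| -> 1 <= \sum_(k in cutQ U) qweight x sq k.
Proof.
move=> oU; rewrite qweight_cut.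
suff : (8 <= 2 * cut_W + #|split_squares| + 6 * #|split_nodes|)%N.
  by rewrite -(ler_nat R) natrD natrD natrM [(6 * _)%:R]natrM; lra.
have [D0|] := eqVneq split_nodes set0.
  by rewrite D0 cards0 muln0 addn0 qcut_ge1_nosplit.
move=> Dn0; have : (0 < #|split_nodes|)%N by rewrite card_gt0.
case: (eqVneq #|split_nodes| 1%N) => [D1 _|]; last by lia.
by have /eqP/cards1P[i Di] := D1; rewrite D1 muln1 (qcut_ge1_split Di).
Qed.

End CutBound.

Lemma qweight_fractional_matching (R : realFieldType) n (x : edge n -> R) (sq : pred 'I_n)
    (p q : 'I_n -> 'I_n) (S : square_matchings x sq p q) :
  (forall e, x e = 0 \/ x e = 1 / 2 \/ x e = 1) -> in_SUBT x ->
  fractional_matching (qsource S) (qtarget S) (qweight x sq).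
Proof.
move=> half sub; split.
- by case=> [e|i] /=; case: ifP => // _; lra.
- exact: qweight_loop.
- exact: qweight_degree.
- exact: qweight_odd_cut.
Qed.

(** * Tours from perfect matchings of Q *)

Section Tours.
Variables (R : realFieldType) (n : nat) (x : edge n -> R) (sq : pred 'I_n).
Variables (p q : 'I_n -> 'I_n).
Variable S : square_matchings x sq p q.
Variable half : forall e, x e = 0 \/ x e = 1 / 2 \/ x e = 1.
Variable sub : in_SUBT x.

Local Notation qedge := (edge n + 'I_n)%type.
Implicit Types (P : {set qedge}) (b : bool) (v : 'I_n).

Definition square_in P v : bool := [exists i in square p q v, inr i \in P].

Definition matched_W P v : nat := (\sum_(e | incident v e) (inl e \in P))%N.

(* kept b v tells whether the edge {v, p v} belongs to the side of its square
   selected by b: it is the same at both ends and opposite on the other side. *)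
Definition kept b v : bool :=
  (minn v (p v) < minn (q v) (p (q v)))%N (+) b.

(** In a square with no copy in [P], the dropped end of a [q]-edge is the second one if the first is
    kept; its 1-edges in [P] give the extra copies of the [q]-edge. *)
Definition tour P b (e : edge n) : nat :=
  (in_W x e * (inl e \in P).+1
   + matched sq p e * (square_in P (val e).1 || kept b (val e).1)
   + matched sq q e * (~~ square_in P (val e).1 *
      (matched_W P (if kept b (val e).1 then (val e).2 else (val e).1)).+1))%N.

Lemma square_p v : sq v -> square p q (p v) = square p q v.
Proof.
move=> sv; have [spv ppv _ _] := S.1 v sv; have [sqv qqv _ qpv] := S.2.1 v sv.
have [_ ppqv _ _] := S.1 _ sqv.
apply/setP=> u; rewrite !inE ppv qpv ppqv.
by case: (u == v); case: (u == p v); case: (u == q v); case: (u == p (q v)).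
Qed.

Lemma square_in_p P v : sq v -> square_in P (p v) = square_in P v.
Proof. by move=> sv; rewrite /square_in square_p. Qed.

Lemma square_in_q P v : sq v -> square_in P (q v) = square_in P v.
Proof. by move=> sv; rewrite /square_in (square_q S). Qed.

Lemma kept_p b v : sq v -> kept b (p v) = kept b v.
Proof.
move=> sv; have [spv ppv _ _] := S.1 v sv; have [sqv qqv _ qpv] := S.2.1 v sv.
have [_ ppqv _ _] := S.1 _ sqv.
by rewrite /kept ppv qpv ppqv minnC [minn (p (q v)) _]minnC.
Qed.

Lemma kept_q b v : sq v -> kept b (q v) = ~~ kept b v.
Proof.
move=> sv; have [spv ppv _ pq] := S.1 v sv; have [sqv qqv qv qpv] := S.2.1 v sv.
rewrite /kept qqv -addNb; congr (_ (+) _); rewrite -leqNgt [RHS]leq_eqVlt.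
suff /negbTE-> : minn (q v) (p (q v)) != minn v (p v) by [].
have /and4P[] := square_card S sv.
rewrite !inE !negb_or => /and3P[_ n2 n3] /andP[n4 n5] _ _.
rewrite /minn; case: ifP => _; case: ifP => _; rewrite val_eqE.
- by rewrite eq_sym.
- by rewrite eq_sym.
- by rewrite eq_sym.
- by rewrite eq_sym.
Qed.

Lemma tour_W P b e : in_W x e -> tour P b e = (inl e \in P).+1.
Proof.
move=> We; rewrite /tour We (in_W_matched S We).
by rewrite (in_W_matched (square_matchingsC S) We) mul1n !addn0.
Qed.

Lemma not_W_matched p' q' e : square_matchings x sq p' q' -> matched sq p' e ->
  in_W x e = false.
Proof. by move=> S' m; apply: contraTF m => We; rewrite (in_W_matched S' We). Qed.

Lemma tour_p P b v e : sq v -> is_edge v (p v) e ->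
  tour P b e = (square_in P v || kept b v).
Proof.
move=> sv ie; have [spv ppv _ _] := S.1 v sv.
have m : matched sq p e by rewrite (matchedE S ie) sv eqxx.
rewrite /tour m (not_W_matched S m) (negbTE (matched_disj S m)) add0n mul1n addn0.
by case/orP: ie => /andP[/eqP-> _]; rewrite ?square_in_p ?kept_p.
Qed.

Lemma tour_q P b v e : sq v -> is_edge v (q v) e ->
  tour P b e = (~~ square_in P v * (matched_W P (if kept b v then q v else v)).+1)%N.
Proof.
move=> sv ie; have [spv ppv _ _] := S.1 v sv; have [sqv qqv _ _] := S.2.1 v sv.
have S' := square_matchingsC S.
have m : matched sq q e by rewrite (matchedE S' ie) sv eqxx.
rewrite /tour m (not_W_matched S' m) (negbTE (matched_disj S' m)) add0n mul1n.
case/orP: ie => /andP[/eqP-> /eqP->] //.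
by rewrite square_in_q // kept_q //; case: (kept b v).
Qed.

Lemma tour_other P b e : ~~ in_W x e -> ~~ in_H x e -> tour P b e = 0%N.
Proof.
by rewrite (in_H_matched e S) negb_or /tour => /negbTE-> /andP[/negbTE-> /negbTE->].
Qed.

Section PM.
Variable P : {set qedge}.
Hypothesis pmP : perfect_matching (qsource S) (qtarget S) P.
Hypothesis suppP : forall e, inl e \in P -> in_W x e.

Lemma card_cut (A : {set qedge}) : #|P :&: A| = (\sum_(k in A) (k \in P))%N.
Proof.
rewrite -sum1_card [RHS]big_mkcond [LHS]big_mkcond; apply: eq_bigr => k _.
by rewrite inE andbC; case: (k \in A).
Qed.

Lemma matched_W_square v : sq v ->
  (matched_W P v + matched_W P (q v) + \sum_(i in square p q v) (inr i \in P) = 1)%N.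
Proof.
move=> sv; rewrite -(pmP (node S v true)) card_cut.
by rewrite (sum_cut_sq S true sv) // => e; apply: contraNeq; rewrite eqb0 negbK; apply: suppP.
Qed.

Lemma sum_square_in v : sq v ->
  (\sum_(i in square p q v) (inr i \in P) = square_in P v)%N.
Proof.
move=> sv; have := matched_W_square sv; rewrite /square_in.
case: existsP => [[i /andP[iv iP]]|none] h.
  by move: h; rewrite (bigD1 i) //= iP; lia.
rewrite big1 // => i iv; apply/eqP; rewrite eqb0; apply/negP=> iP.
by case: none; exists i; rewrite iv.
Qed.

(** Both copies of [v] share the gadget edge, so each meets a 1-edge of [P] exactly when the other
    does. *)
Lemma even_matched_W v : ~~ sq v -> ~~ odd (matched_W P v).
Proof.
move=> sv; have h c := pmP (node S v c).
have := h true; have := h false; rewrite !card_cut !(sum_cut_nsq S _ _ sv).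
have -> : matched_W P v =
  (\sum_(e | incident v e && ((Some e == first_W x v) == true)) (inl e \in P)
   + \sum_(e | incident v e && ((Some e == first_W x v) == false)) (inl e \in P))%N.
  rewrite /matched_W (bigID (fun e => (Some e == first_W x v) == true)).
  by congr (_ + _)%N; apply: eq_bigl => e; case: (Some e == _).
by move: (\sum_(e | _) _)%N (\sum_(e | _) _)%N (inr v \in P) => a c [] /=; lia.
Qed.

Lemma degree_tour_W b v : (\sum_(e | incident v e) in_W x e * (inl e \in P).+1
   = degree (fun e => in_W x e : nat) v + matched_W P v)%N.
Proof.
rewrite /degree /matched_W -big_split; apply: eq_bigr => e _ /=.
by have := @suppP e; case: (inl e \in P) => [->|_] //; rewrite muln1 addn0.
Qed.

(** Off the squares the degree is 2 plus an even number. At a square vertex it is 2 if [P] contains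
    a copy of the square edge; otherwise it is 4 at a kept end and 2 plus twice [matched_W] at a
    dropped end. *)
Lemma even_tour b v : ~~ odd (degree (tour P b) v).
Proof.
rewrite /degree /tour 2!big_split /= degree_tour_W // (degree_W v half S sub).
case: (boolP (sq v)) => sv; last first.
  rewrite [X in (_ + X + _)%N](_ : _ = 0%N) ?[X in (_ + X)%N](_ : _ = 0%N).
  - by rewrite !addn0 oddD /=; apply: even_matched_W.
  - apply: big1 => e /incidentP[u ie].
    by rewrite (matchedE (square_matchingsC S) ie) (negbTE sv).
  - by apply: big1 => e /incidentP[u ie]; rewrite (matchedE S ie) (negbTE sv).
rewrite (@sum_matched _ _ _ _ _ _ S _ _ (square_in P v || kept b v)); last first.
  by move=> e /orP[]/andP[/eqP-> _]; rewrite ?square_in_p ?kept_p.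
rewrite (@sum_matched _ _ _ _ _ _ (square_matchingsC S) _ _
  (~~ square_in P v * (matched_W P (if kept b v then q v else v)).+1)%N); last first.
  move=> e /orP[]/andP[/eqP-> /eqP->] //.
  by rewrite square_in_q // kept_q //; case: (kept b v).
have := matched_W_square sv; rewrite (sum_square_in sv) sv !mul1n.
by case: (square_in P v); case: (kept b v) => /=; lia.
Qed.

Lemma connect_tour b i j :
  connect (adj (two_factor x sq p)) i j -> connect (adj (tour P b)) i j.
Proof.
apply: connect_sub => {}i {}j /existsP[e /andP[te ie]].
case: (boolP (in_W x e)) => We.
  by apply/connect1/(adj_edge ie); rewrite tour_W.
move: te; rewrite /two_factor (negbTE We) (matchedE S ie) add0n lt0b => /andP[si /eqP jp].
rewrite jp in ie *.
have [spi ppi pi pqi] := S.1 i si; have [sqi qqi qi qpi] := S.2.1 i si.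
have [spqi ppqi pqi' _] := S.1 _ sqi.
case: (boolP (square_in P i || kept b i)) => [k|].
  by apply/connect1/(adj_edge ie); rewrite (tour_p _ _ si ie) k.
rewrite negb_or => /andP[ni nk].
(* The dropped edge is bypassed along [i], [q i], [p (q i)], [p i]. *)
have [e1 ie1] : exists e1, is_edge i (q i) e1 by apply: is_edge_exists; rewrite eq_sym.
have [e2 ie2] : exists e2, is_edge (q i) (p (q i)) e2 by apply: is_edge_exists; rewrite eq_sym.
have [e3 ie3] : exists e3, is_edge (p i) (q (p i)) e3.
  by apply: is_edge_exists; rewrite eq_sym; have [] := S.2.1 _ spi.
apply: (@connect_trans _ _ (q i)).
  by apply/connect1/(adj_edge ie1); rewrite (tour_q _ _ si ie1) ni mul1n.
apply: (@connect_trans _ _ (p (q i))).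
  by apply/connect1/(adj_edge ie2); rewrite (tour_p _ _ sqi ie2) kept_q // nk orbT.
rewrite -qpi connect_adjC; apply/connect1/(adj_edge ie3).
by rewrite (tour_q _ _ spi ie3) square_in_p // ni mul1n.
Qed.

End PM.

Lemma tourTF_W P e : in_W x e ->
  (tour P true e)%:R + (tour P false e)%:R = 2 * (1 + (inl e \in P)%:R) :> R.
Proof. by move=> We; rewrite !tour_W // -add1n natrD; ring. Qed.

Lemma tourTF_p P v e : sq v -> is_edge v (p v) e ->
  (tour P true e)%:R + (tour P false e)%:R = 1 + (square_in P v)%:R :> R.
Proof.
move=> sv ie; rewrite !(tour_p _ _ sv ie) /kept addbT addbF.
by case: (square_in P v); case: (_ < _)%N => /=; ring.
Qed.

(** The two tours drop opposite ends of the [q]-edge. If [P] has no copy of the square edge, exactly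
    one of the two ends meets a 1-edge of [P], so the multiplicities are 1 and 2. *)
Lemma tourTF_q P v e : perfect_matching (qsource S) (qtarget S) P ->
  (forall e, inl e \in P -> in_W x e) -> sq v -> is_edge v (q v) e ->
  (tour P true e)%:R + (tour P false e)%:R = 3 * (1 - (square_in P v)%:R) :> R.
Proof.
move=> pmP suppP sv ie; rewrite !(tour_q _ _ sv ie) /kept addbT addbF.
have := matched_W_square pmP suppP sv; rewrite (sum_square_in pmP suppP sv).
case: (square_in P v) => /=; first by move=> _; ring.
rewrite addn0 !mul1n => h.
rewrite -natrD; have -> : (3 : R) * (1 - 0%:R) = 3%:R by ring.
by congr _%:R; case: (_ < _)%N => /=; lia.
Qed.

End Tours.

(** [in_TSP] demands a tour at every index, so indices of weight 0 are given the tour of a fixed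
    index [i0] of nonzero weight. *)
Lemma in_TSP_family (R : numFieldType) n (y : edge n -> R) (I : finType)
    (la : I -> R) (t : I -> edge n -> nat) :
  (forall i, 0 <= la i) -> \sum_i la i = 1 ->
  (forall i, la i != 0 -> is_tour (t i)) ->
  (forall e, y e = \sum_i la i * (t i e)%:R) -> in_TSP y.
Proof.
move=> la0 la1 lat ye.
have [i0 _ nz0] : exists2 i, true & la i != 0.
  case: (pickP (fun i => la i != 0)) => [i|none]; first by exists i.
  move: la1; rewrite big1 => [/eqP|i _]; first by rewrite eq_sym oner_eq0.
  by have := none i => /negbFE/eqP.
exists #|I|, (fun j => la (enum_val j)),
  (fun j => t (if la (enum_val j) == 0 then i0 else enum_val j)); split; [|split; [|split]].
- by move=> j.
- by rewrite -la1 [RHS](reindex _ (onW_bij _ (enum_val_bij I))).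
- by move=> j; apply: lat; case: ifP => [_|/negbT].
- move=> e; rewrite ye [LHS](reindex _ (onW_bij _ (enum_val_bij I))) /=.
  by apply: eq_bigr => j _; case: eqP => // ->; rewrite !mul0r.
Qed.

Theorem mainTheorem6 (R : realFieldType) (n : nat) (x : edge n -> R) :
  (3 <= n)%N -> is_half_cyclic x -> H_union_of_4cycles x ->
  in_TSP (yvec x).
Proof.
move=> _ [sub [half _]] /square_matchings_exist[sq [p0 [q0 S0]]].
have [p [q [S conn]]] := hamiltonian_matching half S0 sub.
have [mu [mu0 mupm mu1 mux]] := perfect_matching_polytope (qweight_fractional_matching S half sub).
have suppP P : mu P != 0 -> forall e, inl e \in P -> in_W x e.
  move=> nz e eP; have := matching_hull_support mu0 mux nz eP => /=.
  by case: ifP => // _; rewrite eqxx.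
(* The mass of each matching is split evenly between its two tours. *)
apply: (@in_TSP_family _ _ _ _ (fun i : {set edge n + 'I_n} * bool => mu i.1 / 2)
  (fun i => tour x sq p q i.1 i.2)).
- by move=> [P b] /=; rewrite divr_ge0.
- rewrite -(pair_bigA _ (fun P (b : bool) => mu P / 2)) /= -[RHS]mu1.
  by apply: eq_bigr => P _; rewrite big_bool /=; field.
- move=> [P b] /= nz; have nzP : mu P != 0 by apply: contraNneq nz => ->; rewrite mul0r.
  split=> [i j|v]; first exact: (connect_tour S).
  exact: (even_tour half sub (mupm P nzP) (suppP P nzP)).
- move=> e; rewrite -(pair_bigA _ (fun P (b : bool) => mu P / 2 * (tour x sq p q P b e)%:R)) /=.
  transitivity (\sum_P mu P * (((tour x sq p q P true e)%:R + (tour x sq p q P false e)%:R) / 2)); last first.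
    by apply: eq_bigr => P _; rewrite big_bool /=; field.
  have muE k : \sum_P mu P * (k \in P)%:R = qweight x sq k.
    rewrite -mux [RHS]big_mkcond; apply: eq_bigr => P _.
    by case: (k \in P); rewrite ?mulr1 ?mulr0.
  (* The four copies of a square edge have total weight 4/8, and a matching contains at most one of
     them. *)
  have muS v : sq v -> \sum_P mu P * (square_in p q P v)%:R = 1 / 2.
    move=> sv; transitivity (\sum_(i in square p q v) qweight x sq (inr i)).
      rewrite (eq_bigr (fun i => \sum_P mu P * (inr i \in P)%:R)) => [|i _]; last by rewrite muE.
      rewrite exchange_big /=; apply: eq_bigr => P _; rewrite -mulr_sumr.
      have [->|nz] := eqVneq (mu P) 0; first by rewrite !mul0r.
      by rewrite -natr_sum (sum_square_in (mupm P nz) (suppP P nz) sv).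
    rewrite (eq_bigr (fun=> 1 / 8)) => [|i /(square_sq S sv) /= -> //].
    by rewrite sumr_const (card_square S sv); field.
  (* The averages are 1 + 1/4 = 5/4 on W, (1 + 1/2)/2 = 3/4 on [p]-edges and 3(1 - 1/2)/2 = 3/4 on
     [q]-edges. *)
  rewrite /yvec; case: ifP => We.
    rewrite (eq_bigr (fun P => mu P + mu P * (inl e \in P)%:R)) => [|P _].
      by rewrite big_split /= mu1 muE /= We; field.
    by rewrite (tourTF_W S) //; field.
  case: ifP => He; last first.
    rewrite big1 // => P _.
    by rewrite !(tour_other S) ?We ?He // addr0 mul0r mulr0.
  have ie := is_edge_self e; have xe : x e = 1 / 2 by apply/eqP.
  have := He; rewrite (in_H_matched e S) => /orP[]/andP[sv /eqP e2]; rewrite e2 in ie.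
    rewrite (eq_bigr (fun P => mu P / 2 + mu P * (square_in p q P (val e).1)%:R / 2)) => [|P _].
      by rewrite big_split /= -!mulr_suml mu1 muS // xe; field.
    by rewrite (tourTF_p S _ sv ie); field.
  rewrite (eq_bigr (fun P => mu P * (3 / 2) - mu P * (square_in p q P (val e).1)%:R * (3 / 2))) => [|P _].
    by rewrite sumrB -!mulr_suml mu1 muS // xe; field.
  have [->|nz] := eqVneq (mu P) 0; first by rewrite !mul0r subr0.
  by rewrite (tourTF_q (mupm P nz) (suppP P nz) sv ie); field.
Qed.
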